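(* Let $\lambda,\mu\in\mathbb{C}$, let $d_1,d_2\in\mathbb{N}$ with $d_1\ge 2d_2-1$, and let $V$ be a simple $\mathcal{G}_{\lambda,\mu}^{(d_1,d_2)}$-module. Suppose there exists $t\in\mathbb{N}$ satisfying the following three conditions: (a) the action of $M_t$ on $V$ is injective; (b) $M_iV=Y_{j-\frac12}V=L_kV=0$ for all integers $i>t$, $j>t+d_2$ and $k>t+d_1$; (c) $\big((\lambda+1)i+t+2\mu\big)\big(i+d_1+\lambda(i+t+d_1)-2\mu\big)\neq 0$ for all $i\in\mathbb{Z}_+$. Then: (I) $\mathrm{Ind}(V)$ is a simple $\mathcal{G}_{\lambda,\mu}$-module; (II) the actions of $M_i$, $Y_{j-\frac12}$, $L_k$ on $\mathrm{Ind}(V)$ are locally nilpotent for all integers $i>t$, $j>t+d_2$ and $k>t+d_1$.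
   Context: $\mathbb{N}$ denotes the nonnegative integers and $\mathbb{Z}_+$ the positive integers. For $\lambda,\mu\in\mathbb{C}$, $\mathcal{G}_{\lambda,\mu}$ (the deformative Schrödinger–Virasoro algebra) is the complex Lie algebra with basis $\{L_m, M_m, Y_{m-\frac12}, C\mid m\in\mathbb{Z}\}$ and brackets, for $m,n\in\mathbb{Z}$, $$[L_m,L_n]=(n-m)L_{m+n}+\delta_{m+n,0}\tfrac{m^3-m}{12}C,\quad [L_m,Y_{n-\frac12}]=\Big(n-\tfrac{\lambda+1}{2}m+\mu-\tfrac12\Big)Y_{m+n-\frac12},$$ $$[Y_{m-\frac12},Y_{n-\frac12}]=(m-n)M_{m+n-1},\quad [L_m,M_n]=(n-\lambda m+2\mu)M_{m+n},$$ $$[M_m,M_n]=[M_m,Y_{n-\frac12}]=[\mathcal{G}_{\lambda,\mu},C]=0.$$ For $d_1,d_2\in\mathbb{N}$ with $d_1\ge 2d_2-1$, $\mathcal{G}_{\lambda,\mu}^{(d_1,d_2)}$ is the subalgebra of $\mathcal{G}_{\lambda,\mu}$ spanned by $C$, all $M_{i-d_1}$ and $L_i$ with $i\in\mathbb{N}$, and all $Y_{i-d_2-\frac12}$ with $i\in\mathbb{Z}_+$. For a $\mathcal{G}_{\lambda,\mu}^{(d_1,d_2)}$-module $V$, the induced module is $\mathrm{Ind}(V)=\mathcal{U}(\mathcal{G}_{\lambda,\mu})\otimes_{\mathcal{U}(\mathcal{G}_{\lambda,\mu}^{(d_1,d_2)})}V$, where $\mathcal{U}$ denotes the universal enveloping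 algebra. Throughout, $C$ is assumed to act on modules as a scalar $c\in\mathbb{C}$. An element $x$ of a Lie algebra acts locally nilpotently on a module $W$ if for every $v\in W$ there is $n\in\mathbb{Z}_+$ with $x^nv=0$. *)

(* Defs.v *)
From HB Require Import structures.
From mathcomp Require Import all_boot all_order all_algebra finmap.
From mathcomp Require Import generic_quotient ring_quotient boolp reals complex.
From mathcomp.multinomials Require Import monalg.
From mathcomp Require Import ring lra zify.

Set Implicit Arguments.
Unset Strict Implicit.
Unset Printing Implicit Defensive.

Import Order.TTheory GRing.Theory Num.Theory.
Local Open Scope ring_scope.
Local Open Scope quotient_scope.

(* {malg F[K]} is the vector space with basis K; <<k>> is the basis vector k. *)
HB.lock Definition linext (F : fieldType) (K : choiceType) (W : lmodType F)
  (f : K -> W) (p : {malg F[K]}) : W := \sum_(k <- msupp p) p@_k *: f k.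

Section LinearExtension.
Variables (F : fieldType) (K : choiceType) (W : lmodType F) (f : K -> W).
Local Notation linext := (linext f).

Lemma linextEw (d : {fset K}) p : fsubset (msupp p) d ->
  linext p = \sum_(k <- d) p@_k *: f k.
Proof.
move=> le_pd; rewrite linext.unlock (big_fset_incl _ le_pd) //= => k _ /mcoeff_outdom ->.
by rewrite scale0r.
Qed.

Lemma linext_is_linear : linear linext.
Proof.
move=> a p q.
pose d := fsetU (msupp p) (msupp q).
have dp : fsubset (msupp p) d by rewrite fsubsetUl.
have dq : fsubset (msupp q) d by rewrite fsubsetUr.
have dpq : fsubset (msupp (a *: p + q)) d.
  apply: fsubset_trans (msuppD_le _ _) _; rewrite fsubUset dq andbT.
  exact: fsubset_trans (msuppZ_le _ _) dp.
rewrite (linextEw dp) (linextEw dq) (linextEw dpq) scaler_sumr -big_split /=.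
by apply: eq_bigr => k _; rewrite mcoeffD mcoeffZ scalerDl scalerA.
Qed.

HB.instance Definition _ :=
  GRing.isLinear.Build F {malg F[K]} W _ linext linext_is_linear.

Lemma linextU k : linext << k >> = f k.
Proof.
rewrite (@linextEw [fset k]%fset) ?msuppU_le //.
by rewrite big_seq_fset1 mcoeffUU scale1r.
Qed.

End LinearExtension.

Lemma malg_linind (F : fieldType) (K : choiceType) (P : {malg F[K]} -> Prop) :
  P 0 -> (forall a k p, P p -> P (a *: << k >> + p)) -> forall p, P p.
Proof.
move=> P0 PD p; rewrite (monalgE p).
elim: (msupp p : seq K) => [|k s IH]; first by rewrite big_nil.
rewrite big_cons; suff -> : << p@_k *g k >> = p@_k *: << k >> by exact: PD.
by apply/malgP => k'; rewrite mcoeffZ !mcoeffU mulrnAr mulr1.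
Qed.

Lemma malg_lineq (F : fieldType) (K : choiceType) (W : lmodType F)
  (f g : {linear {malg F[K]} -> W}) :
  (forall k, f << k >> = g << k >>) -> f =1 g.
Proof.
by move=> fg; elim/malg_linind => [|a k p IH]; rewrite ?linear0 // !linearP fg IH.
Qed.

Section Quotient.
Variables (F : fieldType) (V : lmodType F) (S : V -> Prop).

Inductive lspan : V -> Prop :=
| lspan0 : lspan 0
| lspanZD a u v : S u -> lspan v -> lspan (a *: u + v).

Lemma lspan_lin a u v : lspan u -> lspan v -> lspan (a *: u + v).
Proof.
move=> su sv; elim: su => [|b x y Sx _ IH]; first by rewrite scaler0 add0r.
by rewrite scalerDr scalerA -addrA; exact: lspanZD.
Qed.

Lemma lspan_gen u : S u -> lspan u.
Proof. by move=> Su; rewrite -[u]scale1r -[_ *: _]addr0; apply: lspanZD => //; exact: lspan0. Qed.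

Definition lspan_pred : {pred V} := fun v => `[< lspan v >].

Lemma lspan_predP v : reflect (lspan v) (v \in lspan_pred).
Proof. exact: asboolP. Qed.

Fact lspan_submod_closed : submod_closed lspan_pred.
Proof.
split=> [|a u v]; first by apply/lspan_predP; exact: lspan0.
by move=> /lspan_predP su /lspan_predP sv; apply/lspan_predP; exact: lspan_lin.
Qed.
HB.instance Definition _ :=
  GRing.isSubmodClosed.Build F V lspan_pred lspan_submod_closed.

(* The quotient of V by the linear span of S. *)
Definition lquot : Type := Quotient.quot lspan_pred.
HB.instance Definition _ := ZmodQuotient.on lquot.
HB.instance Definition _ := GRing.Zmodule.on lquot.

Lemma lquot_eqP u v : reflect (lspan (u - v)) (\pi_lquot u == \pi_lquot v).
Proof. by rewrite piE Quotient.equivE; exact: lspan_predP. Qed.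

Definition lquot_scale (a : F) := lift_op1 lquot ( *:%R a).

Lemma pi_lquotZ a : {morph \pi_lquot : x / a *: x >-> lquot_scale a x}.
Proof.
move=> x; unlock lquot_scale; apply/eqP/lquot_eqP; rewrite -scalerBr.
rewrite -[_ *: _]addr0; apply: lspan_lin; last exact: lspan0.
by apply/lquot_eqP; rewrite reprK.
Qed.

Fact lquot_scaleA a b v : lquot_scale a (lquot_scale b v) = lquot_scale (a * b) v.
Proof. by rewrite -[v]reprK -!pi_lquotZ scalerA. Qed.
Fact lquot_scale1 : left_id 1 lquot_scale.
Proof. by move=> v; rewrite -[v]reprK -!pi_lquotZ scale1r. Qed.
Fact lquot_scaleDr : right_distributive lquot_scale +%R.
Proof.
move=> a u v; rewrite -[u]reprK -[v]reprK -raddfD -!pi_lquotZ.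
by rewrite -raddfD scalerDr.
Qed.
Fact lquot_scaleDl v : {morph lquot_scale^~ v : a b / a + b}.
Proof. by move=> a b; rewrite -[v]reprK -!pi_lquotZ scalerDl raddfD. Qed.
HB.instance Definition _ := GRing.Zmodule_isLmodule.Build F lquot
  lquot_scaleA lquot_scale1 lquot_scaleDr lquot_scaleDl.

Lemma pi_lquot_linear a u v :
  \pi_lquot (a *: u + v) = a *: \pi_lquot u + \pi_lquot v.
Proof. by rewrite raddfD /= pi_lquotZ. Qed.

Lemma pi_lquot_eq0 u : lspan u -> \pi_lquot u = 0.
Proof.
by move=> su; rewrite -(raddf0 \pi_lquot); apply/eqP/lquot_eqP; rewrite subr0.
Qed.

End Quotient.

Section LquotLift.
Variables (F : fieldType) (V W : lmodType F) (S : V -> Prop).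
Variable f : {linear V -> W}.
Hypothesis fS : forall u, S u -> f u = 0.

Lemma lspan_lin0 u : lspan S u -> f u = 0.
Proof. by elim=> [|a x y Sx _ IH]; rewrite ?linear0 // linearP fS // IH scaler0 addr0. Qed.

Lemma lquot_reprE u : f (repr (\pi_(lquot S) u)) = f u.
Proof.
apply/eqP; rewrite -subr_eq0 -linearB; apply/eqP/lspan_lin0.
by apply/lquot_eqP; rewrite reprK.
Qed.
End LquotLift.

HB.mixin Record isLieAlgebra (F : fieldType) g of GRing.Lmodule F g := {
  lie : g -> g -> g;
  lie_linearl : forall y, linear (lie^~ y);
  lie_linearr : forall x, linear (lie x);
  liexx : forall x, lie x x = 0;
  lie_jacobi : forall x y z,
    lie x (lie y z) + lie y (lie z x) + lie z (lie x y) = 0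
}.
#[short(type="lieAlgType")]
HB.structure Definition LieAlgebra (F : fieldType) :=
  { g of GRing.Lmodule F g & isLieAlgebra F g }.

HB.mixin Record isLieModule (F : fieldType) (g : lieAlgType F) V
    of GRing.Lmodule F V := {
  lact : g -> V -> V;
  lact_linearl : forall v, linear (lact^~ v);
  lact_linearr : forall x, linear (lact x);
  lact_lie : forall x y v, lact (lie x y) v = lact x (lact y v) - lact y (lact x v)
}.
#[short(type="lieModType")]
HB.structure Definition LieModule (F : fieldType) (g : lieAlgType F) :=
  { V of GRing.Lmodule F V & isLieModule F g V }.

Section LieModuleNotions.
Variables (F : fieldType) (g : lieAlgType F) (V : lieModType g).

Definition is_submodule (W : V -> Prop) : Prop :=
  [/\ W 0, forall a u v, W u -> W v -> W (a *: u + v)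
    & forall (x : g) v, W v -> W (lact x v)].

Definition simple_module : Prop :=
  (exists v : V, v != 0) /\
  forall W, is_submodule W -> (forall v, W v -> v = 0) \/ (forall v, W v).

Definition locally_nilpotent (x : g) : Prop :=
  forall v : V, exists n : nat, (0 < n)%N /\ iter n (lact x) v = 0.

End LieModuleNotions.

Arguments simple_module {F g} V.
Arguments locally_nilpotent {F g} V x.

Section LieSubalgebra.
Variables (F : fieldType) (g : lieAlgType F).

Record lieSubalg := LieSubalg {
  lieSubalg_set : {pred g};
  lieSubalg_submod : submod_closed lieSubalg_set;
  lieSubalg_lie : {in lieSubalg_set &, forall x y, lie x y \in lieSubalg_set}
}.

Variable h : lieSubalg.
HB.instance Definition _ :=
  GRing.isSubmodClosed.Build F g (lieSubalg_set h) (lieSubalg_submod h).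

Definition subLie : Type := {x : g | x \in lieSubalg_set h}.
HB.instance Definition _ := SubChoice.on subLie.
HB.instance Definition _ := [SubChoice_isSubLmodule of subLie by <:].

Definition sub_lie (x y : subLie) : subLie :=
  exist _ (lie (val x) (val y)) (lieSubalg_lie (valP x) (valP y)).

Fact sub_lie_linearl y : linear (sub_lie^~ y).
Proof. by move=> a x x'; apply: val_inj; rewrite /= lie_linearl. Qed.
Fact sub_lie_linearr x : linear (sub_lie x).
Proof. by move=> a y y'; apply: val_inj; rewrite /= lie_linearr. Qed.
Fact sub_liexx x : sub_lie x x = 0.
Proof. by apply: val_inj; rewrite /= liexx. Qed.
Fact sub_lie_jacobi x y z :
  sub_lie x (sub_lie y z) + sub_lie y (sub_lie z x) + sub_lie z (sub_lie x y) = 0.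
Proof. by apply: val_inj; rewrite /= lie_jacobi. Qed.
HB.instance Definition _ := isLieAlgebra.Build F subLie
  sub_lie_linearl sub_lie_linearr sub_liexx sub_lie_jacobi.

End LieSubalgebra.

Section MonoidAlgebra.
Variables (F : fieldType) (K : monomType).

Fact malg_scaleAr a (p q : {malg F[K]}) : a *: (p * q) = p * (a *: q).
Proof.
apply/malgP => k; rewrite mcoeffZ mcoeffMl.
rewrite (mcoeffMlw _ (fsubset_refl _) (msuppZ_le a q)) mulr_sumr.
apply: eq_bigr => k1 _; rewrite mulr_sumr; apply: eq_bigr => k2 _.
by rewrite mcoeffZ mulrnAr [in RHS]mulrCA.
Qed.
End MonoidAlgebra.

(* {malg F[{fmonom X}]} is the free associative unital algebra on the set X;
   free_gen is locked because unification would otherwise unfold products. *)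
HB.lock Definition free_gen (F : fieldType) (X : choiceType) (x : X) :
  {malg F[{fmonom X}]} := << fmu x >>.

Section EnvelopingAlgebra.
Variables (F : fieldType) (g : lieAlgType F).
Local Notation freealg := {malg F[{fmonom g}]}.
Local Notation ugen := (@free_gen F g).

Inductive uenv_rel : freealg -> Prop :=
| uenv_rel_lin a x y : uenv_rel (ugen (a *: x + y) - (a *: ugen x + ugen y))
| uenv_rel_lie x y : uenv_rel (ugen x * ugen y - ugen y * ugen x - ugen (lie x y)).

(* The linear span of uenv_ideal is the two-sided ideal generated by uenv_rel. *)
Definition uenv_ideal (p : freealg) : Prop :=
  exists a r b, uenv_rel r /\ p = a * r * b.

Definition uenv : Type := lquot uenv_ideal.
HB.instance Definition _ := ZmodQuotient.on uenv.
HB.instance Definition _ := GRing.Lmodule.on uenv.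

Lemma uenv_idealMl a p : lspan uenv_ideal p -> lspan uenv_ideal (a * p).
Proof.
elim=> [|b u v [c [r [d [rr ->]]]] _ IH]; first by rewrite mulr0; exact: lspan0.
rewrite mulrDr -malg_scaleAr; apply: lspanZD => //.
by exists (a * c), r, d; split; [exact: rr | rewrite 2!mulrA].
Qed.

Lemma uenv_idealMr a p : lspan uenv_ideal p -> lspan uenv_ideal (p * a).
Proof.
elim=> [|b u v [c [r [d [rr ->]]]] _ IH]; first by rewrite mul0r; exact: lspan0.
rewrite mulrDl -scalerAl; apply: lspanZD => //.
by exists c, r, (d * a); split; [exact: rr | exact/esym/mulrA].
Qed.

Definition uenv_one : uenv := \pi_uenv 1.
Definition uenv_mul := lift_op2 uenv ( *%R : freealg -> freealg -> freealg).

Lemma pi_uenvM : {morph \pi_uenv : p q / p * q >-> uenv_mul p q}.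
Proof.
move=> p q; unlock uenv_mul; apply/eqP/lquot_eqP.
set p' := repr _; set q' := repr _.
have -> : p * q - p' * q' = 1 *: (p * (q - q')) + (p - p') * q'.
  by rewrite scale1r mulrBr mulrBl addrA subrK.
apply: lspan_lin; [apply: uenv_idealMl | apply: uenv_idealMr];
  by apply/lquot_eqP; rewrite reprK.
Qed.

Fact uenv_mulA : associative uenv_mul.
Proof. by move=> x y z; rewrite -[x]reprK -[y]reprK -[z]reprK -!pi_uenvM mulrA. Qed.
Fact uenv_mul1 : left_id uenv_one uenv_mul.
Proof. by move=> x; rewrite -[x]reprK -!pi_uenvM mul1r. Qed.
Fact uenv_mulr1 : right_id uenv_one uenv_mul.
Proof. by move=> x; rewrite -[x]reprK -!pi_uenvM mulr1. Qed.
Fact uenv_mulDl : left_distributive uenv_mul +%R.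
Proof.
move=> x y z; rewrite -[x]reprK -[y]reprK -[z]reprK -raddfD -!pi_uenvM.
by rewrite mulrDl raddfD.
Qed.
Fact uenv_mulDr : right_distributive uenv_mul +%R.
Proof.
move=> x y z; rewrite -[x]reprK -[y]reprK -[z]reprK -raddfD -!pi_uenvM.
by rewrite mulrDr raddfD.
Qed.

(* The augmentation sends 1 to 1 and kills the defining relations. *)
Fact uenv_1neq0 : uenv_one != 0.
Proof.
have [eps [eps1 epsM epsg epsD]] : exists eps : freealg -> F,
    [/\ eps 1 = 1, forall p q, eps (p * q) = eps p * eps q,
        forall x, eps (ugen x) = 0
      & forall a p q, eps (a *: p + q) = a * eps p + eps q].
  exists (mcoeff (mone : {fmonom g})); split.
  - exact: rmorph1.
  - exact: rmorphM.
  - by move=> x; rewrite free_gen.unlock mcoeffU fm1_eq1.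
  - by move=> a p q; rewrite mcoeffD mcoeffZ.
have epsB p q : eps (p - q) = eps p - eps q.
  by rewrite addrC -scaleN1r epsD mulN1r addrC.
have eps0 : eps 0 = 0 by rewrite -(subrr 0) epsB subrr.
rewrite -(raddf0 \pi_uenv); apply/negP => /lquot_eqP; rewrite subr0 => s1.
suff : eps 1 = 0 by move/eqP; rewrite eps1 oner_eq0.
elim: s1 => [|a u v [c [r [d [rr ->]]]] _ IH]; first exact: eps0.
rewrite epsD IH addr0 epsM epsM.
suff -> : eps r = 0 by rewrite mulr0 mul0r mulr0.
case: rr => [b x y|x y].
  by rewrite epsB epsD 3!epsg mulr0 addr0 subr0.
have epsB0 p q : eps p = 0 -> eps q = 0 -> eps (p - q) = 0.
  by move=> p0 q0; rewrite epsB p0 q0 subr0.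
have epsM0 x' y' : eps (ugen x' * ugen y') = 0 by rewrite epsM epsg mul0r.
by apply: (epsB0); [apply: epsB0; exact: epsM0 | exact: epsg].
Qed.
HB.instance Definition _ := GRing.Zmodule_isNzRing.Build uenv
  uenv_mulA uenv_mul1 uenv_mulr1 uenv_mulDl uenv_mulDr uenv_1neq0.

Lemma pi_uenv1 : \pi_uenv 1 = 1. Proof. by []. Qed.

Lemma pi_uenv_mul p q : \pi_uenv (p * q) = \pi_uenv p * \pi_uenv q.
Proof. exact: pi_uenvM. Qed.

Lemma pi_uenvZ a p : \pi_uenv (a *: p) = a *: \pi_uenv p.
Proof. exact: pi_lquotZ. Qed.

Fact uenv_scaleAl a (u v : uenv) : a *: (u * v) = (a *: u) * v.
Proof.
rewrite -[u]reprK -[v]reprK -pi_uenv_mul -!pi_uenvZ -pi_uenv_mul.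
by rewrite scalerAl.
Qed.
HB.instance Definition _ := GRing.Lmodule_isLalgebra.Build F uenv uenv_scaleAl.

Fact uenv_scaleAr a (u v : uenv) : a *: (u * v) = u * (a *: v).
Proof.
rewrite -[u]reprK -[v]reprK -pi_uenv_mul -!pi_uenvZ -pi_uenv_mul.
by rewrite malg_scaleAr.
Qed.
HB.instance Definition _ := GRing.Lalgebra_isAlgebra.Build F uenv uenv_scaleAr.

Definition uinj (x : g) : uenv := \pi_uenv (ugen x).

Lemma uenv_rel_eq p q : uenv_rel (p - q) -> \pi_uenv p = \pi_uenv q.
Proof.
move=> rpq; apply/eqP/lquot_eqP/lspan_gen.
by exists 1, (p - q), 1; split; [exact: rpq | rewrite mul1r mulr1].
Qed.

Lemma uinj_linear : linear uinj.
Proof.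
move=> a x y; rewrite /uinj (uenv_rel_eq (uenv_rel_lin a x y)).
exact: pi_lquot_linear.
Qed.

Lemma uinj_lie x y : uinj (lie x y) = uinj x * uinj y - uinj y * uinj x.
Proof.
rewrite /uinj -(uenv_rel_eq (uenv_rel_lie x y)) raddfB.
by congr (_ - _); exact: pi_uenv_mul.
Qed.

End EnvelopingAlgebra.

(* The algebra map U(h) -> U(g) induced by the inclusion of h in g. *)
Section EnvelopingInclusion.
Variables (F : fieldType) (g : lieAlgType F) (h : lieSubalg g).

Definition freealg_incl : {malg F[{fmonom subLie h}]} -> uenv g :=
  linext (fun w : {fmonom subLie h} => \prod_(x <- (w : seq _)) uinj (val x)).
HB.instance Definition _ := GRing.Linear.on freealg_incl.

Definition uenv_incl (u : uenv (subLie h)) : uenv g := freealg_incl (repr u).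

Lemma freealg_inclU (w : {fmonom subLie h}) :
  freealg_incl << w >> = \prod_(x <- (w : seq _)) uinj (val x).
Proof. exact: linextU. Qed.

Lemma freealg_incl_gen x : freealg_incl (free_gen F x) = uinj (val x).
Proof. by rewrite free_gen.unlock freealg_inclU fmU big_seq1. Qed.

Lemma freealg_incl_lin a p q P Q : freealg_incl p = P -> freealg_incl q = Q ->
  freealg_incl (a *: p + q) = a *: P + Q.
Proof. by move=> <- <-; exact: linearP. Qed.

Lemma freealg_inclM p q : freealg_incl (p * q) = freealg_incl p * freealg_incl q.
Proof.
have U w w' : freealg_incl (<< w >> * << w' >>) =
    freealg_incl << w >> * freealg_incl << w' >>.
  have -> : << w >> * << w' >> = << mmul w w' >> :> {malg F[{fmonom subLie h}]}.
    by rewrite malgM_def fgmulUU mulr1.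
  by rewrite 3!freealg_inclU fmM big_cat.
have M w q' : freealg_incl (<< w >> * q') = freealg_incl << w >> * freealg_incl q'.
  elim/malg_linind: q' => [|b w' q' IH]; first by rewrite mulr0 linear0 mulr0.
  rewrite mulrDr -malg_scaleAr; apply: etrans (freealg_incl_lin b (U w w') IH) _.
  by rewrite (freealg_incl_lin b erefl erefl) mulrDr -scalerAr.
elim/malg_linind: p => [|a w p IH]; first by rewrite mul0r linear0 mul0r.
rewrite mulrDl -scalerAl; apply: etrans (freealg_incl_lin a (M w q) IH) _.
by rewrite (freealg_incl_lin a erefl erefl) mulrDl -scalerAl.
Qed.

Lemma freealg_incl_ideal p : uenv_ideal p -> freealg_incl p = 0.
Proof.
have B p1 p2 P1 P2 : freealg_incl p1 = P1 -> freealg_incl p2 = P2 ->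
    freealg_incl (p1 - p2) = P1 - P2.
  by move=> <- <-; exact: linearB.
case=> a [r [b [rr ->]]]; rewrite 2!freealg_inclM.
suff -> : freealg_incl r = 0 by rewrite mulr0 mul0r.
case: rr => [c x y|x y].
  apply: etrans (B _ _ _ _ (freealg_incl_gen _)
    (freealg_incl_lin c (freealg_incl_gen _) (freealg_incl_gen _))) _.
  by rewrite [val _]linearP uinj_linear subrr.
apply: etrans (B _ _ _ _ (B _ _ _ _ (freealg_inclM _ _) (freealg_inclM _ _))
  (freealg_incl_gen _)) _.
by rewrite 2!freealg_incl_gen uinj_lie subrr.
Qed.

Lemma uenv_inclE p : uenv_incl (\pi_(uenv (subLie h)) p) = freealg_incl p.
Proof. exact: lquot_reprE freealg_incl_ideal p. Qed.

Lemma uenv_incl_inj x : uenv_incl (uinj x) = uinj (val x).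
Proof. by rewrite uenv_inclE freealg_incl_gen. Qed.

Lemma uenv_incl_linear : linear uenv_incl.
Proof.
move=> a u v; rewrite -[u]reprK -[v]reprK -pi_lquot_linear 3!uenv_inclE.
exact: linearP.
Qed.

Lemma uenv_incl1 : uenv_incl 1 = 1.
Proof. by rewrite -pi_uenv1 uenv_inclE freealg_inclU fm1 big_nil. Qed.

Lemma uenv_inclM u v : uenv_incl (u * v) = uenv_incl u * uenv_incl v.
Proof.
by rewrite -[u]reprK -[v]reprK -pi_uenv_mul 3!uenv_inclE freealg_inclM.
Qed.

End EnvelopingInclusion.

(* A module over a Lie algebra g as a module over U(g). *)
Section EnvelopingAction.
Variables (F : fieldType) (g : lieAlgType F) (V : lieModType g).

Definition freealg_act (v : V) : {malg F[{fmonom g}]} -> V :=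
  linext (fun w : {fmonom g} => foldr (@lact _ _ V) v w).
HB.instance Definition _ v := GRing.Linear.on (freealg_act v).

Definition uenv_act (u : uenv g) (v : V) : V := freealg_act v (repr u).

Lemma freealg_actU v (w : {fmonom g}) :
  freealg_act v << w >> = foldr (@lact _ _ V) v w.
Proof. exact: linextU. Qed.

Lemma freealg_act_gen v x : freealg_act v (free_gen F x) = lact x v.
Proof. by rewrite free_gen.unlock freealg_actU fmU. Qed.

Lemma freealg_act_lin a v p q P Q : freealg_act v p = P -> freealg_act v q = Q ->
  freealg_act v (a *: p + q) = a *: P + Q.
Proof. by move=> <- <-; exact: linearP. Qed.

Lemma freealg_act_linear p : linear (freealg_act^~ p).
Proof.
move=> a v v'; elim/malg_linind: p => [|b w p IH].
  by rewrite 3!(linear0 (freealg_act _)) scaler0 addr0.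
have U : freealg_act (a *: v + v') << w >> =
    a *: freealg_act v << w >> + freealg_act v' << w >>.
  rewrite 3!freealg_actU.
  by elim: (w : seq g) => [|x s IHs] //=; rewrite IHs lact_linearr.
apply: etrans (freealg_act_lin b U IH) _.
rewrite 2!(freealg_act_lin b erefl erefl) (scalerDr a) addrACA.
by rewrite scalerA mulrC -scalerA -scalerDr.
Qed.

Lemma freealg_act0 p : freealg_act 0 p = 0.
Proof.
have := freealg_act_linear p (-1) 0 0.
by rewrite scaler0 addr0 scaleN1r addNr.
Qed.

Lemma freealg_actM p q v : freealg_act v (p * q) = freealg_act (freealg_act v q) p.
Proof.
have U w w' : freealg_act v (<< w >> * << w' >>) =
    freealg_act (freealg_act v << w' >>) << w >>.
  have -> : << w >> * << w' >> = << mmul w w' >> :> {malg F[{fmonom g}]}.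
    by rewrite malgM_def fgmulUU mulr1.
  by rewrite 3!freealg_actU fmM foldr_cat.
have M w q' : freealg_act v (<< w >> * q') = freealg_act (freealg_act v q') << w >>.
  elim/malg_linind: q' => [|b w' q' IH].
    by rewrite mulr0 linear0 freealg_act0.
  rewrite mulrDr -malg_scaleAr; apply: etrans (freealg_act_lin b (U w w') IH) _.
  by rewrite (freealg_act_lin b erefl erefl) freealg_act_linear.
elim/malg_linind: p => [|a w p IH]; first by rewrite mul0r 2!(linear0 (freealg_act _)).
rewrite mulrDl -scalerAl; apply: etrans (freealg_act_lin a (M w q) IH) _.
exact: esym (freealg_act_lin a erefl erefl).
Qed.

Lemma freealg_act_ideal v p : uenv_ideal p -> freealg_act v p = 0.
Proof.
have B v1 p1 p2 P1 P2 : freealg_act v1 p1 = P1 -> freealg_act v1 p2 = P2 ->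
    freealg_act v1 (p1 - p2) = P1 - P2.
  by move=> <- <-; exact: linearB.
case=> a [r [b [rr ->]]]; rewrite 2!freealg_actM; move: (freealg_act v b) => {}v.
suff -> : freealg_act v r = 0 by exact: freealg_act0.
case: rr => [c x y|x y].
  apply: etrans (B _ _ _ _ _ (freealg_act_gen _ _)
    (freealg_act_lin c (freealg_act_gen _ _) (freealg_act_gen _ _))) _.
  by rewrite lact_linearl subrr.
apply: etrans (B _ _ _ _ _ (B _ _ _ _ _ (freealg_actM _ _ _) (freealg_actM _ _ _))
  (freealg_act_gen _ _)) _.
by rewrite 4!freealg_act_gen lact_lie subrr.
Qed.

Lemma uenv_actE p v : uenv_act (\pi_(uenv g) p) v = freealg_act v p.
Proof. exact: lquot_reprE (@freealg_act_ideal v) p. Qed.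

Lemma uenv_act_inj x v : uenv_act (uinj x) v = lact x v.
Proof. by rewrite uenv_actE freealg_act_gen. Qed.

Lemma uenv_act_linearl v : linear (uenv_act^~ v).
Proof.
move=> a u u'; rewrite -[u]reprK -[u']reprK -pi_lquot_linear 3!uenv_actE.
exact: linearP.
Qed.

Lemma uenv_act_linearr u : linear (uenv_act u).
Proof. by move=> a v v'; exact: freealg_act_linear. Qed.

Lemma uenv_act1 v : uenv_act 1 v = v.
Proof. by rewrite -pi_uenv1 uenv_actE freealg_actU fm1. Qed.

Lemma uenv_actM u u' v : uenv_act (u * u') v = uenv_act u (uenv_act u' v).
Proof.
by rewrite -[u]reprK -[u']reprK -pi_uenv_mul 3!uenv_actE freealg_actM.
Qed.

End EnvelopingAction.

Section InducedModule.
Variables (F : fieldType) (g : lieAlgType F) (h : lieSubalg g).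
Variable V : lieModType (subLie h).

(* The defining relations of the tensor product of the right U(h)-module U(g)
   and the left U(h)-module V, in the vector space with basis U(g) * V. *)
Inductive tensor_rel : {malg F[(uenv g * V)%type]} -> Prop :=
| tensor_rel_linl a u u' v :
    tensor_rel (<< (a *: u + u', v) >> - (a *: << (u, v) >> + << (u', v) >>))
| tensor_rel_linr a u v v' :
    tensor_rel (<< (u, a *: v + v') >> - (a *: << (u, v) >> + << (u, v') >>))
| tensor_rel_bal u (b : uenv (subLie h)) v :
    tensor_rel (<< (u * uenv_incl b, v) >> - << (u, uenv_act b v) >>).

Definition Ind : Type := lquot tensor_rel.
HB.instance Definition _ := ZmodQuotient.on Ind.
HB.instance Definition _ := GRing.Lmodule.on Ind.

Definition tens (u : uenv g) (v : V) : Ind := \pi_Ind << (u, v) >>.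

Lemma tens_linl v : linear (tens^~ v).
Proof.
move=> a u u'; apply/eqP; rewrite -pi_lquot_linear; apply/lquot_eqP/lspan_gen.
exact: tensor_rel_linl.
Qed.

Lemma tens_linr u : linear (tens u).
Proof.
move=> a v v'; apply/eqP; rewrite -pi_lquot_linear; apply/lquot_eqP/lspan_gen.
exact: tensor_rel_linr.
Qed.

Lemma tens_bal u b v : tens (u * uenv_incl b) v = tens u (uenv_act b v).
Proof. by apply/eqP/lquot_eqP/lspan_gen; exact: tensor_rel_bal. Qed.

(* x acts by x (u (x) v) = (x u) (x) v. *)
Definition free_tensor_act (x : g) : {malg F[(uenv g * V)%type]} -> Ind :=
  linext (fun uv => tens (uinj x * uv.1) uv.2).
HB.instance Definition _ x := GRing.Linear.on (free_tensor_act x).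

Definition Ind_act (x : g) (w : Ind) : Ind := free_tensor_act x (repr w).

Lemma free_tensor_act_rel x r : tensor_rel r -> free_tensor_act x r = 0.
Proof.
have E u v : free_tensor_act x << (u, v) >> = tens (uinj x * u) v.
  exact: linextU.
have L a p q r' P Q R : free_tensor_act x p = P -> free_tensor_act x q = Q ->
    free_tensor_act x r' = R -> P = a *: Q + R ->
    free_tensor_act x (p - (a *: q + r')) = 0.
  by move=> fp fq fr pqr; rewrite linearB linearP /= fp fq fr pqr subrr.
case=> [a u u' v|a u v v'|u b v].
- apply: L; [exact: E | exact: E | exact: E |].
  by rewrite mulrDr -scalerAr tens_linl.
- apply: L; [exact: E | exact: E | exact: E |]; exact: tens_linr.
- rewrite linearB; apply/eqP; rewrite subr_eq0; apply/eqP.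
  by apply: etrans (E _ _) (etrans _ (esym (E _ _))); rewrite mulrA tens_bal.
Qed.

Lemma Ind_actE x p : Ind_act x (\pi_Ind p) = free_tensor_act x p.
Proof. exact: lquot_reprE (@free_tensor_act_rel x) p. Qed.

Fact Ind_act_linearr x : linear (Ind_act x).
Proof.
move=> a w w'; rewrite -[w]reprK -[w']reprK -pi_lquot_linear 3!Ind_actE.
exact: linearP.
Qed.
HB.instance Definition _ x :=
  GRing.isLinear.Build F Ind Ind _ (Ind_act x) (Ind_act_linearr x).

Lemma Ind_act_tens x u v : Ind_act x (tens u v) = tens (uinj x * u) v.
Proof. by rewrite Ind_actE; exact: linextU. Qed.

Lemma Ind_ind (P : Ind -> Prop) :
  P 0 -> (forall a u v w, P w -> P (a *: tens u v + w)) -> forall w, P w.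
Proof.
move=> P0 PD w; rewrite -[w]reprK; elim/malg_linind: (repr w) => [|a [u v] p IH].
  by have -> : \pi_Ind 0 = 0 by exact: raddf0.
by rewrite pi_lquot_linear; exact: PD.
Qed.

Fact Ind_act_linearl w : linear (Ind_act^~ w).
Proof.
move=> a x y; elim/Ind_ind: w => [|b u v w IH].
  rewrite !(linear0 (Ind_act _)).
  by rewrite scaler0 addr0.
rewrite !linearP /= IH !Ind_act_tens uinj_linear mulrDl -scalerAl tens_linl.
by rewrite !scalerDr !scalerA mulrC addrACA.
Qed.

Fact Ind_act_lie x y w :
  Ind_act (lie x y) w = Ind_act x (Ind_act y w) - Ind_act y (Ind_act x w).
Proof.
elim/Ind_ind: w => [|b u v w IH]; first by rewrite !(linear0 (Ind_act _)) subrr.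
have E x' y' : Ind_act x' (Ind_act y' (b *: tens u v + w)) =
    b *: tens (uinj x' * uinj y' * u) v + Ind_act x' (Ind_act y' w).
  by rewrite Ind_act_linearr Ind_act_tens Ind_act_linearr Ind_act_tens mulrA.
rewrite (E x y) (E y x) Ind_act_linearr IH Ind_act_tens uinj_lie mulrBl.
have D u1 u2 : tens (u1 - u2) v = tens u1 v - tens u2 v.
  by rewrite -scaleN1r addrC tens_linl scaleN1r addrC.
by rewrite D scalerBr opprD addrACA.
Qed.

HB.instance Definition _ := isLieModule.Build F g Ind
  Ind_act_linearl Ind_act_linearr Ind_act_lie.

Lemma Ind_act_tens1 (x : subLie h) v : lact (val x) (tens 1 v) = tens 1 (lact x v).
Proof.
rewrite -[lact (val x) _]/(Ind_act (val x) _) Ind_act_tens mulr1.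
by rewrite -uenv_incl_inj -uenv_act_inj -tens_bal mul1r.
Qed.

End InducedModule.

Arguments Ind {F g h} V.

(* bY m stands for Y_{m - 1/2}. *)
Inductive svbasis := bL of int | bM of int | bY of int | bC.

Definition svbasis_code (b : svbasis) : option (int + int + int) :=
  match b with
  | bL m => Some (inl (inl m))
  | bM m => Some (inl (inr m))
  | bY m => Some (inr m)
  | bC => None
  end.
Definition svbasis_decode (c : option (int + int + int)) : svbasis :=
  match c with
  | Some (inl (inl m)) => bL m
  | Some (inl (inr m)) => bM m
  | Some (inr m) => bY m
  | None => bC
  end.
Fact svbasis_codeK : cancel svbasis_code svbasis_decode.
Proof. by case. Qed.
HB.instance Definition _ := Choice.copy svbasis (can_type svbasis_codeK).

Definition SV (F : numFieldType) (lam mu : F) : Type := {malg F[svbasis]}.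

(* Locked, so that unification does not compare basis vectors by unfolding. *)
HB.lock Definition sv_basis (F : numFieldType) (lam mu : F) (b : svbasis) :
  SV lam mu := << b >>.

Section SchrodingerVirasoro.
Variables (F : numFieldType) (lam mu : F).
Local Notation SV := (SV lam mu).
Local Notation svb := (@sv_basis F lam mu).

HB.instance Definition _ := GRing.Lmodule.on SV.

Definition svL (m : int) : SV := svb (bL m).
Definition svM (m : int) : SV := svb (bM m).
Definition svY (m : int) : SV := svb (bY m).
Definition svC : SV := svb bC.

Definition sv_bracketLL (m n : int) : SV :=
  (n - m)%:~R *: svL (m + n)
  + ((m + n == 0)%:R * ((m ^+ 3 - m)%:~R / 12)) *: svC.
Definition sv_bracketLY (m n : int) : SV :=
  (n%:~R - (lam + 1) / 2 * m%:~R + mu - 1 / 2) *: svY (m + n).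
Definition sv_bracketYY (m n : int) : SV := (m - n)%:~R *: svM (m + n - 1).
Definition sv_bracketLM (m n : int) : SV :=
  (n%:~R - lam * m%:~R + 2 * mu) *: svM (m + n).

Definition sv_bracket (a b : svbasis) : SV :=
  match a, b with
  | bL m, bL n => sv_bracketLL m n
  | bL m, bY n => sv_bracketLY m n
  | bY n, bL m => - sv_bracketLY m n
  | bL m, bM n => sv_bracketLM m n
  | bM n, bL m => - sv_bracketLM m n
  | bY m, bY n => sv_bracketYY m n
  | bM _, bM _ | bM _, bY _ | bY _, bM _ | bC, _ | _, bC => 0
  end.

Lemma SV_ind (P : SV -> Prop) :
  P 0 -> (forall a b x, P x -> P (a *: svb b + x)) -> forall x, P x.
Proof.
move=> P0 PD; elim/malg_linind => [|a b x IH]; first exact: P0.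
by have := PD a b x IH; rewrite sv_basis.unlock.
Qed.

Definition sv_lie (x y : SV) : SV :=
  linext (fun a => linext (sv_bracket a) y) x.

Fact sv_lie_linearl y : linear (sv_lie^~ y).
Proof. by move=> a x x'; rewrite /sv_lie linearP. Qed.

Lemma sv_lie0 y : sv_lie 0 y = 0.
Proof. exact: linear0. Qed.

Fact sv_lie_linearr x : linear (sv_lie x).
Proof.
move=> a y y'; elim/SV_ind: x => [|b k p IH].
  by rewrite 3!sv_lie0 scaler0 addr0.
rewrite !sv_lie_linearl IH scalerDr [RHS]addrACA; congr (_ + _).
by rewrite sv_basis.unlock /sv_lie !linextU linearP scalerDr !scalerA mulrC.
Qed.
HB.instance Definition _ x :=
  GRing.isLinear.Build F SV SV _ (sv_lie x) (sv_lie_linearr x).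

Lemma sv_lieU a b : sv_lie (svb a) (svb b) = sv_bracket a b.
Proof. by rewrite !sv_basis.unlock /sv_lie !linextU. Qed.

Lemma sv_bracketC a b : sv_bracket a b = - sv_bracket b a.
Proof.
case: a b => [m|m|m|] [n|n|n|] //=; rewrite ?oppr0 ?opprK //.
- rewrite /sv_bracketLL opprD -scaleNr -scaleNr [n + m]addrC.
  have -> : - (m - n)%:~R = (n - m)%:~R :> F by rewrite -intrN opprB.
  suff -> : - ((m + n == 0)%:R * ((n ^+ 3 - n)%:~R / 12)) =
      (m + n == 0)%:R * ((m ^+ 3 - m)%:~R / 12) :> F by [].
  case: eqP => [mn0|_]; last by rewrite !mul0r oppr0.
  have -> : n = - m by lia.
  by rewrite !mul1r; field.
- by rewrite /sv_bracketYY; apply/esym; rewrite -scaleNr -intrN opprB [m + n]addrC.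
Qed.

Lemma sv_lieC x y : sv_lie x y = - sv_lie y x.
Proof.
elim/SV_ind: x => [|a k x IH].
  by rewrite sv_lie0 (linear0 (sv_lie y)) oppr0.
rewrite sv_lie_linearl sv_lie_linearr IH opprD; congr (_ + _).
rewrite -scalerN; congr (_ *: _).
elim/SV_ind: y {IH} => [|b k' y IH].
  by rewrite sv_lie0 (linear0 (sv_lie _)) oppr0.
rewrite sv_lie_linearl sv_lie_linearr IH opprD; congr (_ + _).
by rewrite -scalerN !sv_lieU sv_bracketC.
Qed.

Fact sv_liexx x : sv_lie x x = 0.
Proof.
have N0 (u : SV) : u = - u -> u = 0.
  have n2 : (2%:R == 0 :> F) = false by rewrite pnatr_eq0.
  move/eqP; rewrite -subr_eq0 opprK -mulr2n -scaler_nat scaler_eq0 n2 orFb.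
  by move=> /eqP ->.
exact: N0 (sv_lieC x x).
Qed.

Let jac x y z :=
  sv_lie x (sv_lie y z) + sv_lie y (sv_lie z x) + sv_lie z (sv_lie x y).

Lemma sv_jacC x y z : jac x y z = jac y z x.
Proof. exact: etrans (esym (addrA _ _ _)) (addrC _ _). Qed.

Lemma sv_jac_lin a x x' y z : jac (a *: x + x') y z = a *: jac x y z + jac x' y z.
Proof.
have G (p p' q q' r r' : SV) : (a *: p + p') + (a *: q + q') + (a *: r + r') =
    a *: (p + q + r) + (p' + q' + r').
  by rewrite 2!scalerDr (addrACA (a *: p) p') (addrACA (a *: p + a *: q)).
rewrite /jac sv_lie_linearl (sv_lie_linearr z) (sv_lie_linearr y).
by rewrite (sv_lie_linearl y) (sv_lie_linearr z).
Qed.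

Lemma sv_lieZ a x y : sv_lie x (a *: y) = a *: sv_lie x y.
Proof. exact: linearZ. Qed.
Lemma sv_lieN x y : sv_lie x (- y) = - sv_lie x y.
Proof. exact: linearN. Qed.
Lemma sv_lieD x y z : sv_lie x (y + z) = sv_lie x y + sv_lie x z.
Proof. exact: linearD. Qed.

Let coc (m n : int) : F := (m + n == 0)%:R * ((m ^+ 3 - m)%:~R / 12).

Lemma sv_lieL_LL m n k : sv_lie (svb (bL m)) (sv_lie (svb (bL n)) (svb (bL k))) =
  ((k - n)%:~R * (n + k - m)%:~R) *: svL (m + n + k)
  + ((k - n)%:~R * coc m (n + k)) *: svC.
Proof.
rewrite [in X in sv_lie _ X]sv_lieU /= /sv_bracketLL sv_lieD 2!sv_lieZ 2!sv_lieU /=.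
rewrite (_ : m + n + k = m + (n + k)); last by ring.
by rewrite /coc scaler0 addr0 /sv_bracketLL scalerDr 2!scalerA.
Qed.

Lemma sv_jacLLL m n k : jac (svb (bL m)) (svb (bL n)) (svb (bL k)) = 0.
Proof.
have G (a b a' b' a'' b'' : F) (u v : SV) : a + a' + a'' = 0 -> b + b' + b'' = 0 ->
    a *: u + b *: v + (a' *: u + b' *: v) + (a'' *: u + b'' *: v) = 0.
  move=> a0 b0; rewrite (addrACA (a *: u)) (addrACA (a *: u + a' *: u)).
  by rewrite -4!scalerDl a0 b0 2!scale0r addr0.
rewrite /jac 3!sv_lieL_LL.
have -> : n + k + m = m + n + k by ring.
have -> : k + m + n = m + n + k by ring.
apply: G; first by ring.
rewrite /coc (_ : n + (k + m) = m + (n + k)); last by ring.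
rewrite (_ : k + (m + n) = m + (n + k)); last by ring.
case: eqP => [mnk|_]; last by rewrite 3!mul0r 3!mulr0 2!addr0.
have -> : k = - m - n by lia.
by field.
Qed.

Lemma sv_jac_LL m n (b : svbasis) (u : SV) (p q r : F) :
  sv_lie (svb (bL m)) (sv_lie (svb (bL n)) (svb b)) = p *: u ->
  sv_lie (svb (bL n)) (sv_lie (svb (bL m)) (svb b)) = q *: u ->
  sv_lie (svb b) (sv_lie (svb (bL m)) (svb (bL n))) = r *: u ->
  p - q + r = 0 -> jac (svb (bL m)) (svb (bL n)) (svb b) = 0.
Proof.
move=> e1 e2 e3 pqr; rewrite /jac e1 e3 (sv_lieC (svb b)) sv_lieN e2.
by rewrite -scaleNr -2!scalerDl pqr scale0r.
Qed.

Lemma sv_jacLLM m n k : jac (svb (bL m)) (svb (bL n)) (svb (bM k)) = 0.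
Proof.
apply: (@sv_jac_LL m n (bM k) (svM (m + n + k))).
- rewrite [in X in sv_lie _ X]sv_lieU /= /sv_bracketLM sv_lieZ sv_lieU /=.
  by rewrite /sv_bracketLM scalerA addrA.
- rewrite [in X in sv_lie _ X]sv_lieU /= /sv_bracketLM sv_lieZ sv_lieU /=.
  by rewrite /sv_bracketLM scalerA (addrCA n m) addrA.
- rewrite [in X in sv_lie _ X]sv_lieU /= /sv_bracketLL sv_lieD 2!sv_lieZ 2!sv_lieU /=.
  by rewrite scaler0 addr0 /sv_bracketLM scalerN -scaleNr scalerA.
by ring.
Qed.

Lemma sv_jacLLY m n k : jac (svb (bL m)) (svb (bL n)) (svb (bY k)) = 0.
Proof.
apply: (@sv_jac_LL m n (bY k) (svY (m + n + k))).
- rewrite [in X in sv_lie _ X]sv_lieU /= /sv_bracketLY sv_lieZ sv_lieU /=.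
  by rewrite /sv_bracketLY scalerA addrA.
- rewrite [in X in sv_lie _ X]sv_lieU /= /sv_bracketLY sv_lieZ sv_lieU /=.
  by rewrite /sv_bracketLY scalerA (addrCA n m) addrA.
- rewrite [in X in sv_lie _ X]sv_lieU /= /sv_bracketLL sv_lieD 2!sv_lieZ 2!sv_lieU /=.
  by rewrite scaler0 addr0 /sv_bracketLY scalerN -scaleNr scalerA.
by field.
Qed.

Lemma sv_jacLYY m n k : jac (svb (bL m)) (svb (bY n)) (svb (bY k)) = 0.
Proof.
have E1 : sv_lie (svb (bL m)) (sv_lie (svb (bY n)) (svb (bY k))) =
    ((n - k)%:~R * ((n + k - 1)%:~R - lam * m%:~R + 2 * mu)) *: svM (m + n + k - 1).
  rewrite [in X in sv_lie _ X]sv_lieU /= /sv_bracketYY sv_lieZ sv_lieU /=.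
  by rewrite /sv_bracketLM scalerA (_ : m + (n + k - 1) = m + n + k - 1) //; ring.
have E2 : sv_lie (svb (bY n)) (sv_lie (svb (bL m)) (svb (bY k))) =
    ((k%:~R - (lam + 1) / 2 * m%:~R + mu - 1 / 2) * (n - (m + k))%:~R)
    *: svM (m + n + k - 1).
  rewrite [in X in sv_lie _ X]sv_lieU /= /sv_bracketLY sv_lieZ sv_lieU /=.
  by rewrite /sv_bracketYY scalerA (addrCA n m) addrA.
have E3 : sv_lie (svb (bY k)) (sv_lie (svb (bL m)) (svb (bY n))) =
    ((n%:~R - (lam + 1) / 2 * m%:~R + mu - 1 / 2) * (k - (m + n))%:~R)
    *: svM (m + n + k - 1).
  rewrite [in X in sv_lie _ X]sv_lieU /= /sv_bracketLY sv_lieZ sv_lieU /=.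
  by rewrite /sv_bracketYY scalerA (_ : k + (m + n) - 1 = m + n + k - 1) //; ring.
rewrite /jac E1 E3 (sv_lieC (svb (bY k)) (svb (bL m))) sv_lieN E2.
rewrite -scaleNr -2!scalerDl; set c := (X in X *: _).
suff -> : c = 0 by rewrite scale0r.
by rewrite /c; field.
Qed.

Lemma sv_jacU a b c : jac (svb a) (svb b) (svb c) = 0.
Proof.
have z0 x : sv_lie x 0 = 0 by exact: linear0.
case: a b c => [m|m|m|] [n|n|n|] [k|k|k|];
match goal with
| |- jac (svb (bL _)) (svb (bL _)) (svb (bL _)) = 0 => exact: sv_jacLLL
| |- jac (svb (bL _)) (svb (bL _)) (svb (bM _)) = 0 => exact: sv_jacLLM
| |- jac (svb (bL _)) (svb (bM _)) (svb (bL _)) = 0 => rewrite 2!sv_jacC; exact: sv_jacLLM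
| |- jac (svb (bM _)) (svb (bL _)) (svb (bL _)) = 0 => rewrite sv_jacC; exact: sv_jacLLM
| |- jac (svb (bL _)) (svb (bL _)) (svb (bY _)) = 0 => exact: sv_jacLLY
| |- jac (svb (bL _)) (svb (bY _)) (svb (bL _)) = 0 => rewrite 2!sv_jacC; exact: sv_jacLLY
| |- jac (svb (bY _)) (svb (bL _)) (svb (bL _)) = 0 => rewrite sv_jacC; exact: sv_jacLLY
| |- jac (svb (bL _)) (svb (bY _)) (svb (bY _)) = 0 => exact: sv_jacLYY
| |- jac (svb (bY _)) (svb (bL _)) (svb (bY _)) = 0 => rewrite sv_jacC; exact: sv_jacLYY
| |- jac (svb (bY _)) (svb (bY _)) (svb (bL _)) = 0 => rewrite 2!sv_jacC; exact: sv_jacLYY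
| _ => rewrite /jac; repeat (first
    [ match goal with |- context [sv_lie _ 0] => rewrite z0 end
    | match goal with |- context [sv_lie _ (- _)] => rewrite sv_lieN end
    | match goal with |- context [sv_lie _ (_ + _)] => rewrite sv_lieD end
    | match goal with |- context [sv_lie _ (_ *: _)] => rewrite sv_lieZ end
    | match goal with |- context [sv_lie (svb _) (svb _)] => rewrite sv_lieU /= end
    | match goal with |- context [_ *: (0 : SV)] => rewrite scaler0 end
    | match goal with |- context [- (0 : SV)] => rewrite oppr0 end
    | match goal with |- context [(_ : SV) + 0] => rewrite addr0 end
    | progress rewrite /sv_bracketLL /sv_bracketLM /sv_bracketLY /sv_bracketYY /svL /svM /svY /svC ]);
    reflexivity
end.
Qed.

Fact sv_lie_jacobi x y z :
  sv_lie x (sv_lie y z) + sv_lie y (sv_lie z x) + sv_lie z (sv_lie x y) = 0.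
Proof.
rewrite -/(jac x y z).
have lin0 y' z' : jac 0 y' z' = 0.
  have := sv_jac_lin 0 0 0 y' z'; rewrite !scale0r !add0r => e.
  by have := sv_jac_lin (-1) 0 0 y' z'; rewrite scaler0 addr0 scaleN1r addNr.
elim/SV_ind: x => [|a i x IHx]; first exact: lin0.
rewrite sv_jac_lin IHx addr0 sv_jacC; clear IHx x.
elim/SV_ind: y => [|b j y IHy]; first by rewrite lin0 scaler0.
rewrite sv_jac_lin scalerDr IHy addr0 sv_jacC; clear IHy y.
elim/SV_ind: z => [|c k z IHz]; first by rewrite lin0 !scaler0.
by rewrite sv_jac_lin 2!scalerDr IHz addr0 sv_jacC sv_jacU !scaler0.
Qed.

HB.instance Definition _ := isLieAlgebra.Build F SV
  sv_lie_linearl sv_lie_linearr sv_liexx sv_lie_jacobi.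

Section Subalgebra.
Variables d1 d2 : nat.

Definition svsub_gen (x : SV) : Prop :=
  [\/ x = svC, exists i : nat, x = svM (i%:Z - d1%:Z),
      exists i : nat, x = svL i%:Z
    | exists i : nat, (0 < i)%N /\ x = svY (i%:Z - d2%:Z)].

Hypothesis hd : 2 * d2%:Z - 1 <= d1%:Z.

Fact svsub_gen_lie x y :
  svsub_gen x -> svsub_gen y -> lspan svsub_gen (sv_lie x y).
Proof.
have S0 : lspan svsub_gen 0 by exact: lspan0.
have SZ c u : svsub_gen u -> lspan svsub_gen (c *: u).
  by move=> Su; rewrite -[_ *: _]addr0; apply: lspan_lin; [exact: lspan_gen|].
have SN u : lspan svsub_gen u -> lspan svsub_gen (- u).
  by move=> Su; rewrite -scaleN1r -[_ *: _]addr0; apply: lspan_lin.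
have GM (m : int) : 0 <= m + d1%:Z -> svsub_gen (svM m).
  by move=> m0; apply: Or42; exists (absz (m + d1%:Z)%R); congr svM; lia.
have GL (m : int) : 0 <= m -> svsub_gen (svL m).
  by move=> m0; apply: Or43; exists (absz (m)%R); congr svL; lia.
have GY (m : int) : 0 < m + d2%:Z -> svsub_gen (svY m).
  move=> m0; apply: Or44; exists (absz (m + d2%:Z)%R); split; first by lia.
  by congr svY; lia.
have SLM (m n : int) : 0 <= m + n + d1%:Z -> lspan svsub_gen (sv_bracketLM m n).
  by move=> mn; apply: SZ; exact: GM.
have SLY (m n : int) : 0 < m + n + d2%:Z -> lspan svsub_gen (sv_bracketLY m n).
  by move=> mn; apply: SZ; exact: GY.
case=> [->|[i ->]|[i ->]|[i [i0 ->]]]; case=> [->|[j ->]|[j ->]|[j [j0 ->]]];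
  rewrite /svC /svM /svL /svY sv_lieU /=; try exact: S0.
- by apply/SN/SLM; lia.
- by apply: SLM; lia.
- apply: lspan_lin; first by apply/lspan_gen/GL; lia.
  by apply: SZ; exact: Or41.
- by apply: SLY; lia.
- by apply/SN/SLY; lia.
- rewrite /sv_bracketYY; case: (eqVneq i j) => [->|ij].
    by rewrite subrr mulr0z scale0r.
  by apply/SZ/GM; move/eqP: ij; lia.
Qed.

Fact svsub_lie_closed :
  {in lspan_pred svsub_gen &, forall x y, lie x y \in lspan_pred svsub_gen}.
Proof.
move=> x y /lspan_predP Sx /lspan_predP Sy; apply/lspan_predP.
rewrite [lie x y](_ : _ = sv_lie x y) //.
elim: Sx => [|a u v Su _ IH]; first by rewrite sv_lie0; exact: lspan0.
rewrite sv_lie_linearl; apply: lspan_lin => {IH}//.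
elim: Sy => [|b w z Sw _ IH]; first by rewrite (linear0 (sv_lie u)); exact: lspan0.
by rewrite sv_lie_linearr; apply: lspan_lin => {IH}//; exact: svsub_gen_lie.
Qed.

Definition svsub : lieSubalg SV :=
  LieSubalg (lspan_submod_closed svsub_gen) svsub_lie_closed.

Lemma svsub_genP x : svsub_gen x -> exists y : subLie svsub, \val y = x.
Proof. by move=> /lspan_gen/lspan_predP Sx; exists (exist _ x Sx). Qed.

End Subalgebra.

End SchrodingerVirasoro.

Arguments svL {F lam mu} m.
Arguments svM {F lam mu} m.
Arguments svY {F lam mu} m.
Arguments svC {F lam mu}.
Arguments svsub {F} lam mu {d1 d2} hd.

Notation SVsub lam mu hd := (subLie (svsub lam mu hd)).

(* Main.v *)
(* Straightening words in the basis letters of the algebra by the rules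
   ab = ba + [a,b] and (u h) (x) v = u (x) h v, which terminate and are confluent by the
   Jacobi identity, gives a retraction Ind(V) -> V of v |-> 1 (x) v (the part of the
   Poincare-Birkhoff-Witt theorem that is needed): so Ind(V) is nonzero.

   Filter Ind(V) by a weighted degree of the words in the letters outside of the
   subalgebra.  On the associated graded space these letters commute and M_t acts through V,
   while M_{t+i}, L_{t+d1+i}, Y_{t+d2+i-1/2} act as a nonzero multiple of M_t times the
   derivation with respect to L_{-i}, M_{-d1-i}, Y_{-d2-i+1/2}; nonvanishing is
   hypothesis (c).  If s is a leading word of w <> 0, the product of the dual letters of s
   therefore maps w into 1 (x) V, to a nonzero vector because M_t is injective.  Elements
   of negative degree are locally nilpotent since the degrees of words are nonnegative. *)
From HB Require Import structures.
Require Import Defs.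
From mathcomp Require Import all_boot all_order all_algebra reals complex.
From mathcomp Require Import generic_quotient ring_quotient boolp.
From mathcomp.multinomials Require Import monalg.
From mathcomp Require Import ring zify.

Set Implicit Arguments.
Unset Strict Implicit.
Unset Printing Implicit Defensive.

Import Order.TTheory GRing.Theory Num.Theory.
Local Open Scope ring_scope.
Local Open Scope quotient_scope.

(** * Straightening words *)

Section Inversions.
Variables (K : eqType) (lt : rel K).
Hypothesis lt_irr : irreflexive lt.
Hypothesis lt_trans : transitive lt.
Implicit Types (u w : seq K).

Fixpoint inversions w : nat :=
  if w is a :: w' then (count (fun b => lt b a) w' + inversions w')%N else 0%N.

Lemma inversions_le w : (inversions w <= size w * size w)%N.
Proof.
elim: w => [|a w IH] //=; have := count_size (fun b => lt b a) w; nia.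
Qed.

Lemma inversions_swap u a b w : lt b a ->
  inversions (u ++ a :: b :: w) = (inversions (u ++ b :: a :: w)).+1.
Proof.
move=> ba; have ab : lt a b = false.
  by apply/negP => /(lt_trans ba); rewrite lt_irr.
elim: u => [|c u IH] /=; first by rewrite ba ab; lia.
by rewrite IH !count_cat /=; lia.
Qed.

(* Orders words by length, then by number of inversions. *)
Definition word_measure w : nat := (size w * size w * size w + inversions w)%N.

Lemma word_measure_swap u a b w : lt b a ->
  (word_measure (u ++ b :: a :: w) < word_measure (u ++ a :: b :: w))%N.
Proof.
by move=> ba; rewrite /word_measure (inversions_swap _ _ ba) !size_cat /=; lia.
Qed.

(** Inversions number at most the square of the length, and the cube of the length grows by more
    than that when a letter is added. *)
Lemma word_measure_size w w' : size w' = (size w).+1 ->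
  (word_measure w < word_measure w')%N.
Proof. by rewrite /word_measure => ->; have := inversions_le w; nia. Qed.

(** Picking the leftmost adjacent inversion makes straightening a function; that the choice is
    immaterial is [straighten_confluent]. *)
Fixpoint redex w : option (seq K * K * K * seq K) :=
  if w is a :: w' then
    if w' is b :: w'' then
      if lt b a then Some ([::], a, b, w'')
      else if redex w' is Some (u, c, d, s) then Some (a :: u, c, d, s) else None
    else None
  else None.

Lemma redexP w u a b s : redex w = Some (u, a, b, s) ->
  w = u ++ a :: b :: s /\ lt b a.
Proof.
elim: w u => [|c [|d w] IH] u //=.
case: ifP => [dc [<- <- <- <-]|_] //.
case E : (match w with [::] => None | _ => _ end) => [[[[u' a'] b'] s']|] // eq.
case: eq => eu ea eb es; rewrite -eu; have [|-> ?] // := IH u'.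
by rewrite -ea -eb -es.
Qed.

Lemma redex_ex u a b s : lt b a -> redex (u ++ a :: b :: s) <> None.
Proof.
move=> ba; elim: u => [|c u IH] /=; first by rewrite ba.
case E : (u ++ _) => [|d w]; first by case: (u) E.
by case: ifP => // _; rewrite -E; case: (redex _) IH => [[[[? ?] ?] ?]|].
Qed.

Lemma redex_rcons u a : redex (rcons u a) = None -> redex u = None.
Proof.
case E : (redex u) => [[[[s b] c] s']|] //.
by have [-> cb] := redexP E; rewrite rcons_cat /= => /(redex_ex cb).
Qed.

End Inversions.

(** * Identities in Lie algebras and their modules *)

Section LieLemmas.
Variables (F : fieldType) (g : lieAlgType F).
Implicit Types x y z : g.

HB.instance Definition _ x := GRing.isLinear.Build F g g _ (lie x) (lie_linearr x).

Lemma lieC x y : lie x y = - lie y x.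
Proof.
have Dl z x' y' : lie (x' + y') z = lie x' z + lie y' z.
  by have := lie_linearl z 1 x' y'; rewrite !scale1r.
have := liexx (x + y); rewrite linearD /= !Dl !liexx add0r addr0 addrC => /eqP.
by rewrite addr_eq0 => /eqP.
Qed.

Lemma lie0l x : lie 0 x = 0. Proof. by rewrite lieC linear0 oppr0. Qed.

(** The arrangement of the Jacobi identity that is left over when three letters are reversed in two
    ways. *)
Lemma jacobi_ad x y z :
  lie (lie x y) z - lie (lie x z) y + lie (lie y z) x = 0.
Proof.
have -> : lie (lie x y) z = - lie z (lie x y) by exact: lieC.
have -> : lie (lie x z) y = lie y (lie z x) by rewrite lieC (lieC x) linearN opprK.
rewrite (lieC (lie y z)) -!opprD [X in - X = 0](_ : _ = 0) ?oppr0 //.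
by rewrite -(lie_jacobi x y z) addrC addrA addrAC.
Qed.

End LieLemmas.

Section ModuleLemmas.
Variables (F : fieldType) (g : lieAlgType F) (V : lieModType g).

HB.instance Definition _ (x : g) :=
  GRing.isLinear.Build F V V _ (@lact F g V x) (lact_linearr x).

Lemma lact_lin (a : F) (x y : g) (v : V) : lact (a *: x + y) v = a *: lact x v + lact y v.
Proof. exact: lact_linearl. Qed.

Lemma lact0 (v : V) : lact (0 : g) v = 0.
Proof. by have := lact_lin (-1) 0 0 v; rewrite scaler0 addr0 scaleN1r addNr. Qed.

Lemma lactZ (a : F) (x : g) (v : V) : lact (a *: x) v = a *: lact x v.
Proof. by rewrite -[a *: x]addr0 lact_lin lact0 addr0. Qed.

End ModuleLemmas.

(** * Linear maps on U(g) given by functions of words *)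

Section Sandwich.
Variables (F : fieldType) (A : lalgType F).
Hypothesis scaleAr : forall a (p q : A), a *: (p * q) = p * (a *: q).
Implicit Types w x y z : A.

Lemma sandwich_lin w w' a x y z :
  w * (x - (a *: y + z)) * w' = w * x * w' - (a *: (w * y * w') + w * z * w').
Proof. by rewrite mulrBr mulrBl mulrDr mulrDl -scaleAr -scalerAl. Qed.

Lemma sandwich_lie w w' x y z :
  w * (x * y - y * x - z) * w' = w * x * y * w' - w * y * x * w' - w * z * w'.
Proof. by rewrite !mulrBr !mulrBl !mulrA. Qed.

Lemma mulZDl a x y z : (a *: x + y) * z = a *: (x * z) + y * z.
Proof. by rewrite mulrDl -scalerAl. Qed.

Lemma sandwich_linl w w' a x y : (a *: x + y) * w * w' = a *: (x * w * w') + y * w * w'.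
Proof. by rewrite !mulrDl -!scalerAl. Qed.

Lemma sandwich_linr w w' a x y : w * w' * (a *: x + y) = a *: (w * w' * x) + w * w' * y.
Proof. by rewrite mulrDr -scaleAr. Qed.

End Sandwich.


Section WordFunctional.
Variables (F : fieldType) (g : lieAlgType F) (V : lmodType F) (f : seq g -> V).
Hypothesis f_lin : forall s s' a x y,
  f (s ++ (a *: x + y) :: s') = a *: f (s ++ x :: s') + f (s ++ y :: s').
Hypothesis f_lie : forall s x y s',
  f (s ++ x :: y :: s') - f (s ++ y :: x :: s') = f (s ++ lie x y :: s').
Local Notation freealg := {malg F[{fmonom g}]}.

Definition word_ext : freealg -> V := linext (fun w : {fmonom g} => f w).
HB.instance Definition _ := GRing.Linear.on word_ext.

Lemma word_extU (w : {fmonom g}) : word_ext << w >> = f w.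
Proof. exact: linextU. Qed.

Lemma word_ext_lin a p q : word_ext (a *: p + q) = a *: word_ext p + word_ext q.
Proof. exact: linearP. Qed.

Lemma word_extB p q : word_ext (p - q) = word_ext p - word_ext q.
Proof. exact: linearB. Qed.

Lemma word_ext0 : word_ext 0 = 0.
Proof. exact: linear0. Qed.

Lemma malg_mulU (w w' : {fmonom g}) : << w >> * << w' >> = << mmul w w' >> :> freealg.
Proof. by rewrite malgM_def fgmulUU mulr1. Qed.

Lemma word_ext1 (w w' : {fmonom g}) x :
  word_ext (<< w >> * free_gen F x * << w' >>) = f ((w : seq g) ++ x :: (w' : seq g)).
Proof. 
rewrite free_gen.unlock.
have -> := malg_mulU w (fmu x).
have -> := malg_mulU (mmul w (fmu x)) w'.
by rewrite word_extU !fmM !fmU -catA.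
Qed.

Lemma word_ext2 (w w' : {fmonom g}) x y :
  word_ext (<< w >> * free_gen F x * free_gen F y * << w' >>)
  = f ((w : seq g) ++ x :: y :: (w' : seq g)).
Proof. 
rewrite free_gen.unlock.
have -> := malg_mulU w (fmu x).
have -> := malg_mulU (mmul w (fmu x)) (fmu y).
have -> := malg_mulU (mmul (mmul w (fmu x)) (fmu y)) w'.
by rewrite word_extU !fmM !fmU -!catA. 
Qed.

Lemma word_ext_rel (w w' : {fmonom g}) r : uenv_rel r ->
  word_ext (<< w >> * r * << w' >>) = 0.
Proof.
have E a p q s P Q S : word_ext p = P -> word_ext q = Q -> word_ext s = S ->
    word_ext (p - (a *: q + s)) = P - (a *: Q + S).
  by move=> <- <- <-; rewrite word_extB word_ext_lin.
have E' p q s P Q S : word_ext p = P -> word_ext q = Q -> word_ext s = S ->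
    word_ext (p - q - s) = P - Q - S.
  by move=> <- <- <-; rewrite !word_extB.
case=> [a x y|x y].
  apply: etrans (congr1 word_ext (sandwich_lin (@malg_scaleAr _ _) _ _ _ _ _ _)) _.
  apply: etrans (E _ _ _ _ _ _ _ (word_ext1 _ _ _) (word_ext1 _ _ _) (word_ext1 _ _ _)) _.
  by rewrite f_lin subrr.
apply: etrans (congr1 word_ext (sandwich_lie _ _ _ _ _)) _.
apply: etrans (E' _ _ _ _ _ _ (word_ext2 _ _ _ _) (word_ext2 _ _ _ _) (word_ext1 _ _ _)) _.
by rewrite f_lie subrr.
Qed.

(** By linearity in both outer factors it is enough to place a defining relation between two words,
    where [f_lin] or [f_lie] applies. *)
Lemma word_ext_ideal p : uenv_ideal p -> word_ext p = 0.
Proof.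
have E a p' q P : word_ext p' = 0 -> word_ext q = 0 -> P = a *: p' + q -> word_ext P = 0.
  by move=> p0 q0 ->; rewrite word_ext_lin p0 q0 scaler0 addr0.
case=> a [r [b [rr ->]]].
elim/malg_linind: a => [|c w a IHa].
  by rewrite -mulrA [X in word_ext X]mul0r word_ext0.
apply: (E _ _ _ _ _ IHa (sandwich_linl _ _ _ _ _)).
elim/malg_linind: b {IHa} => [|d w' b IHb].
  by rewrite [X in word_ext X]mulr0 word_ext0.
exact: (E _ _ _ _ (word_ext_rel _ _ rr) IHb (sandwich_linr (@malg_scaleAr _ _) _ _ _ _ _)).
Qed.

Definition uenv_word_ext (u : uenv g) : V := word_ext (repr u).

Lemma uenv_word_extE p : uenv_word_ext (\pi_(uenv g) p) = word_ext p.
Proof. exact: lquot_reprE word_ext_ideal p. Qed.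

Lemma uenv_word_ext_linear : linear uenv_word_ext.
Proof.
move=> a u u'; rewrite -[u]reprK -[u']reprK -pi_lquot_linear !uenv_word_extE.
exact: word_ext_lin.
Qed.

End WordFunctional.

(** * Straightening and its confluence *)

Section Straightening.
Variables (F : fieldType) (g : lieAlgType F) (h : lieSubalg g).
Variable V : lieModType (subLie h).
(* e is a basis of g, with coordinates coord. *)
Variables (K : choiceType) (e : K -> g) (coord : {linear g -> {malg F[K]}}).
Hypothesis coordE : forall k, coord (e k) = << k >>.
Hypothesis e_ind : forall P : g -> Prop,
  P 0 -> (forall a k x, P x -> P (a *: e k + x)) -> forall x, P x.
Variables (lt : rel K) (is_sub : pred K).
Hypothesis lt_irr : irreflexive lt.
Hypothesis lt_trans : transitive lt.
Hypothesis lt_total : forall a b, a != b -> lt a b || lt b a.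
Hypothesis lt_sub : forall a b, is_sub a -> lt a b -> is_sub b.
Hypothesis is_subP : forall a, is_sub a -> e a \in lieSubalg_set h.
Hypothesis h_ind : forall P : subLie h -> Prop, P 0 ->
  (forall a k (x y : subLie h), is_sub k -> val x = e k -> P y -> P (a *: x + y)) ->
  forall x, P x.

Definition lin_ext (f : K -> V) (x : g) : V := linext f (coord x).

Lemma lin_ext_linear f : linear (lin_ext f).
Proof. by move=> a x y; rewrite /lin_ext linearP; exact: linearP. Qed.
HB.instance Definition _ f := GRing.isLinear.Build F g V _ (lin_ext f) (lin_ext_linear f).

Lemma lin_extE f k : lin_ext f (e k) = f k.
Proof. by rewrite /lin_ext coordE linextU. Qed.

Lemma lin_ext_eq (f f' : K -> V) : f =1 f' -> lin_ext f =1 lin_ext f'.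
Proof.
move=> ff'; elim/e_ind => [|a k x IH]; first by rewrite !linear0.
by rewrite !lin_ext_linear !lin_extE ff' IH.
Qed.

Lemma lin_ext_linf a (f f' : K -> V) x :
  lin_ext (fun k => a *: f k + f' k) x = a *: lin_ext f x + lin_ext f' x.
Proof.
elim/e_ind: x => [|b k x IH]; first by rewrite !linear0 addr0.
rewrite !lin_ext_linear !lin_extE IH !scalerDr !scalerA [b * a]mulrC.
by rewrite !addrA; congr (_ + _); rewrite -!addrA; congr (_ + _); rewrite addrC.
Qed.

Lemma lin_extD (f f' : K -> V) x : lin_ext (fun k => f k + f' k) x = lin_ext f x + lin_ext f' x.
Proof.
by rewrite -[lin_ext f x]scale1r -lin_ext_linf; apply: lin_ext_eq => k; rewrite scale1r.
Qed.

(** Interchange of two finite sums over coordinates. *)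
Lemma lin_extC (f : K -> K -> V) x y :
  lin_ext (fun k => lin_ext (f k) y) x = lin_ext (fun l => lin_ext (f^~ l) x) y.
Proof.
elim/e_ind: x => [|b k x IH].
  rewrite linear0; elim/e_ind: y => [|a l y IH]; first by rewrite linear0.
  by rewrite lin_ext_linear lin_extE linear0 scaler0 add0r.
rewrite lin_ext_linear lin_extE IH -lin_ext_linf; apply: lin_ext_eq => l.
by rewrite lin_ext_linear lin_extE.
Qed.

(** [insubd] falls back on 0 when [e k] is outside of h; the value matters only for letters
    satisfying [is_sub]. *)
Definition hact (k : K) (v : V) : V := lact (insubd (0 : subLie h) (e k)) v.

Lemma hactE (k : K) (x : subLie h) v : is_sub k -> val x = e k -> hact k v = lact x v.
Proof.
move=> hk xk; rewrite /hact; congr (lact _ v); apply: val_inj.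
by rewrite insubdK // is_subP.
Qed.

Lemma hact_linear k : linear (hact k).
Proof. exact: lact_linearr. Qed.

Lemma foldr_hact_linear w : linear (fun v => foldr hact v w).
Proof. by elim: w => [|k w IH] a u v //=; rewrite IH hact_linear. Qed.

(* A word without inversions has its letters outside of h first; the retraction kills
   it if there is one. *)
Definition sorted_act (w : seq K) (v : V) : V := if all is_sub w then foldr hact v w else 0.

(** [n] is fuel; the default 0 is never reached if the fuel exceeds the measure. The bracket is a
    combination of letters, hence the linear extension. *)
Fixpoint straighten_rec (n : nat) (w : seq K) (v : V) : V :=
  if n is n'.+1 then
    if redex lt w is Some (u, a, b, s) then
      straighten_rec n' (u ++ b :: a :: s) v
      + lin_ext (fun c => straighten_rec n' (u ++ c :: s) v) (lie (e a) (e b))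
    else sorted_act w v
  else 0.

Local Notation mu := (word_measure lt).

Lemma measure_swap u a b s : lt b a -> (mu (u ++ b :: a :: s) < mu (u ++ a :: b :: s))%N.
Proof. exact: word_measure_swap. Qed.

Lemma measure_del u a b c s : (mu (u ++ c :: s) < mu (u ++ a :: b :: s))%N.
Proof. by apply: word_measure_size; rewrite !size_cat /= !addnS. Qed.

(** Both the swap and the bracket term lower the measure, so surplus fuel has no influence. *)
Lemma straighten_recE n n' w v : (mu w < n)%N -> (mu w < n')%N ->
  straighten_rec n w v = straighten_rec n' w v.
Proof.
elim: n n' w => [|n IH] [|n'] w //= wn wn'.
case E : (redex lt w) => [[[[u a] b] s]|] //.
have [ew ba] := redexP E; rewrite ew in wn wn'.
have m1 := measure_swap u s ba.
have m2 c := measure_del u a b c s.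
congr (_ + _); first by apply: IH; apply: leq_trans m1 _.
by apply: lin_ext_eq => c; apply: IH; apply: leq_trans (m2 c) _.
Qed.

Definition straighten w v := straighten_rec (mu w).+1 w v.

Lemma straightenE w v : straighten w v =
  if redex lt w is Some (u, a, b, s) then
    straighten (u ++ b :: a :: s) v
    + lin_ext (fun c => straighten (u ++ c :: s) v) (lie (e a) (e b))
  else sorted_act w v.
Proof.
rewrite {1}/straighten /=.
case E : (redex lt w) => [[[[u a] b] s]|] //.
have [ew ba] := redexP E; rewrite ew.
congr (_ + _); first by apply: straighten_recE => //; exact: measure_swap.
by apply: lin_ext_eq => c; apply: straighten_recE => //; exact: measure_del.
Qed.

Lemma straighten0 v : straighten [::] v = v.
Proof. by rewrite straightenE. Qed.

Lemma straighten_linear w : linear (straighten w).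
Proof.
have [n] := ubnP (mu w); elim: n w => // n IH w wn a u v.
rewrite !straightenE; case E : (redex lt w) => [[[[u' c] d] s]|].
  have [ew dc] := redexP E; rewrite ew in wn.
  rewrite IH; last exact: leq_trans (measure_swap u' s dc) wn.
  rewrite scalerDr [RHS]addrACA -lin_ext_linf.
  by congr (_ + _); apply: lin_ext_eq => k; exact/IH/(leq_trans (measure_del u' c d k s) wn).
rewrite /sorted_act; case: ifP => _; first exact: foldr_hact_linear.
by rewrite scaler0 addr0.
Qed.

HB.instance Definition _ w := GRing.isLinear.Build F V V _ (straighten w) (straighten_linear w).

(** Reducing any adjacent inversion first, and not just the leftmost one, leads to the same
    vector. *)
Definition confluent_at w : Prop := forall u a b s v, w = u ++ a :: b :: s -> lt b a ->
  straighten w v =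
  straighten (u ++ b :: a :: s) v + lin_ext (fun c => straighten (u ++ c :: s) v) (lie (e a) (e b)).

(** Frees the rule from the order of the letters: if [a] precedes [b], it is applied to the swapped
    word and antisymmetry of the bracket restores the sign. *)
Lemma confluent_swap u a b s v :
  confluent_at (u ++ a :: b :: s) -> confluent_at (u ++ b :: a :: s) ->
  straighten (u ++ a :: b :: s) v - straighten (u ++ b :: a :: s) v =
  lin_ext (fun c => straighten (u ++ c :: s) v) (lie (e a) (e b)).
Proof.
move=> sab sba; have [->|ab] := eqVneq a b.
  by rewrite liexx linear0 subrr.
have /orP [lab|lba] := lt_total ab.
  by rewrite (sba u b a s v) // lieC linearN /= opprD opprK addrA subrr add0r.
by rewrite (sab u a b s v) // addrAC subrr add0r.
Qed.

Lemma confluent_swap_ext u (x : g) c s v :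
  (forall d, confluent_at (u ++ d :: c :: s) /\ confluent_at (u ++ c :: d :: s)) ->
  lin_ext (fun d => straighten (u ++ d :: c :: s) v) x
  - lin_ext (fun d => straighten (u ++ c :: d :: s) v) x
  = lin_ext (fun d => straighten (u ++ d :: s) v) (lie x (e c)).
Proof.
move=> st; elim/e_ind: x => [|a k x IH]; first by rewrite lie0l !linear0 addr0.
have [st1 st2] := st k.
rewrite !lin_ext_linear !lin_extE /= opprD addrACA -scalerN -scalerDr IH.
by rewrite (confluent_swap _ st1 st2) lie_linearl lin_ext_linear.
Qed.

Lemma confluent_atP u t a b s v : confluent_at (u ++ t ++ a :: b :: s) -> lt b a ->
  straighten (u ++ t ++ a :: b :: s) v = straighten (u ++ t ++ b :: a :: s) v
    + lin_ext (fun c => straighten (u ++ t ++ c :: s) v) (lie (e a) (e b)).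
Proof.
move=> st ba; rewrite (st (u ++ t) a b s v) ?catA //; congr (_ + _).
by apply: lin_ext_eq => c; rewrite catA.
Qed.

Lemma addr_sub3 (W : zmodType) (z p1 p2 p3 p4 p5 p6 : W) :
  (p5 - p4) - (p3 - p1) + (p2 - p6) = 0 -> z + p2 + p1 + p5 = z + p4 + p3 + p6.
Proof.
move=> E; apply/eqP; rewrite -subr_eq0 -[X in _ == X]E !opprD !opprK !addrA.
rewrite [X in X == _](ACl ((4*6)*(7*3)*(2*8)*(1*5)))/= subrr addr0.
by rewrite !addrA.
Qed.

(** The diamond lemma for two redexes, the first strictly to the left. Words of smaller measure are
    confluent, so both results can be reduced further until they meet. *)
Lemma confluent_step u0 a0 b0 s0 u a b s v :
  (size u0 < size u)%N -> u0 ++ a0 :: b0 :: s0 = u ++ a :: b :: s ->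
  lt b0 a0 -> lt b a ->
  (forall w, (mu w < mu (u ++ a :: b :: s))%N -> confluent_at w) ->
  straighten (u0 ++ b0 :: a0 :: s0) v
  + lin_ext (fun c => straighten (u0 ++ c :: s0) v) (lie (e a0) (e b0)) =
  straighten (u ++ b :: a :: s) v + lin_ext (fun c => straighten (u ++ c :: s) v) (lie (e a) (e b)).
Proof.
move=> su ew ba0 ba IH.
(* [m] lies between [a0] and the second redex: it is empty if the redexes share a letter and starts
   with [b0] otherwise. *)
have {su} [m eu] : exists m, u = u0 ++ a0 :: m.
  exists (take (size u - size u0).-1 (b0 :: s0)).
  have := congr1 (take (size u)) ew.
  rewrite [RHS]take_size_cat // take_cat ltnNge (ltnW su) /= => {1}<-.
  by case: (size u - size u0)%N (subn_gt0 (size u0) (size u)) => [|n]; rewrite su.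
have es0 : b0 :: s0 = m ++ a :: b :: s.
  by have /eqP := ew; rewrite eu -catA eqseq_cat //= eqxx eqseq_cons eqxx => /eqP.
rewrite -{}ew in IH.
have sz w : (size w).+1 = size (u0 ++ a0 :: b0 :: s0) -> confluent_at w.
  by move=> sw; apply: IH; apply: word_measure_size.
case: m => [|c m] in eu es0.
  (* Overlap a0 a b: both sides are carried to the reversed word b a a0, and the remaining bracket
     terms differ by a Jacobi sum. *)
  case: es0 => eb es; subst u b0 s0.
  have ab0 := lt_trans ba ba0.
  have m1 := measure_swap u0 (b :: s) ba0.
  have m2 : (mu (u0 ++ a :: b :: a0 :: s) < mu (u0 ++ a :: a0 :: b :: s))%N.
    by have := measure_swap (u0 ++ [:: a]) s ab0; rewrite -!catA.
  have m3 : (mu (u0 ++ a0 :: b :: a :: s) < mu (u0 ++ a0 :: a :: b :: s))%N.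
    by have := measure_swap (u0 ++ [:: a0]) s ba; rewrite -!catA.
  have m4 := measure_swap u0 (a :: s) ab0.
  rewrite (@confluent_atP _ [:: a]) //=; last exact: IH.
  rewrite (@confluent_atP _ [::] a b) //=; last by apply: IH; apply: ltn_trans m2 m1.
  rewrite -catA /= (@confluent_atP _ [::] a0 b) //=; last exact: IH.
  rewrite (@confluent_atP _ [:: b] a0 a) //=; last by apply: IH; apply: ltn_trans m4 m3.
  rewrite (@lin_ext_eq (fun c => straighten ((u0 ++ [:: a0]) ++ c :: s) v)
            (fun c => straighten (u0 ++ a0 :: c :: s) v)); last by move=> k; rewrite -catA.
  have s3 k l : confluent_at (u0 ++ k :: l :: s) by apply: sz; rewrite !size_cat /= !addnS.
  apply: addr_sub3; rewrite !confluent_swap_ext //.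
  by rewrite -linearB -linearD /= jacobi_ad linear0.
(* Disjoint redexes: each side also performs the reduction of the other, and the terms with two
   brackets agree by [lin_extC]. *)
case: es0 => eb es; subst u c s0; rewrite -!catA /=.
rewrite (@confluent_atP u0 (b0 :: a0 :: m) a b) //; last exact/IH/measure_swap.
rewrite (@confluent_atP u0 [::] a0 b0 (m ++ b :: a :: s)) //=; last first.
  apply: IH; have := measure_swap (u0 ++ a0 :: b0 :: m) s ba.
  by rewrite -!catA.
rewrite -[LHS]addrA -[RHS]addrA; congr (_ + _).
have E2 k : straighten (u0 ++ k :: m ++ a :: b :: s) v = straighten (u0 ++ k :: m ++ b :: a :: s) v
    + lin_ext (fun l => straighten (u0 ++ k :: m ++ l :: s) v) (lie (e a) (e b)).
  by apply: (@confluent_atP u0 (k :: m)) => //; apply: sz; rewrite !size_cat /= !size_cat /= !addnS.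
have E4 l : straighten ((u0 ++ a0 :: b0 :: m) ++ l :: s) v =
    straighten (u0 ++ b0 :: a0 :: m ++ l :: s) v
    + lin_ext (fun k => straighten (u0 ++ k :: m ++ l :: s) v) (lie (e a0) (e b0)).
  rewrite -catA; apply: (@confluent_atP u0 [::] a0 b0 (m ++ l :: s)) => //.
  by apply: sz; rewrite !size_cat /= !size_cat /= !addnS.
rewrite (lin_ext_eq E2) (lin_ext_eq E4) !lin_extD [in LHS]lin_extC.
by rewrite addrCA.
Qed.

Lemma straighten_confluent w : confluent_at w.
Proof.
have [n] := ubnP (mu w); elim: n w => // n IH w wn u a b s v ew ba.
rewrite straightenE; case E : (redex lt w) => [[[[u0 a0] b0] s0]|]; last first.
  by have := redex_ex (lt := lt) (u := u) (s := s) ba; rewrite -ew.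
have [ew0 ba0] := redexP E.
have {}IH w' : (mu w' < mu w)%N -> confluent_at w'.
  by move=> w'w; apply: IH; apply: leq_trans w'w _.
have [lt1|lt2|eu] := ltngtP (size u0) (size u).
- by apply: confluent_step => //; rewrite -?ew0 -?ew.
- by apply/esym/confluent_step => //; rewrite -?ew0 -?ew.
- by have /eqP := etrans (esym ew0) ew; rewrite eqseq_cat // !eqseq_cons
    => /andP[/eqP -> /and3P[/eqP -> /eqP -> /eqP ->]].
Qed.

Lemma straighten_ext_sub u v :
  (forall k, is_sub k -> straighten (u ++ [:: k]) v = straighten u (hact k v)) ->
  forall x : subLie h, lin_ext (fun k => straighten (u ++ [:: k]) v) (val x)
  = straighten u (lact x v).
Proof.
move=> IH; elim/h_ind => [|a k x y hk xk IHx].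
  by rewrite lact0 !linear0.
by rewrite [val _]linearP /= xk lin_ext_linear lin_extE IH // IHx lact_lin linearP (hactE v hk xk).
Qed.

(** This makes straightening balanced over U(h). The proof is by induction on the measure, according
    to whether the redex involves the last letter. *)
Lemma straighten_rcons u k v : is_sub k -> straighten (u ++ [:: k]) v = straighten u (hact k v).
Proof.
have [n] := ubnP (mu (u ++ [:: k])); elim: n u k v => // n IH u k v un hk.
rewrite straightenE; case E : (redex lt (u ++ [:: k])) => [[[[u1 a] b] s]|]; last first.
  have En : redex lt u = None by apply: (@redex_rcons _ _ _ k); rewrite -cats1.
  by rewrite straightenE En /sorted_act all_cat foldr_cat /= hk !andbT.
have [ew ba] := redexP E; rewrite ew in un.
case/lastP: s => [|s k'] in ew un E *.
  have [eu ek] : u = rcons u1 a /\ k = b.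
    have /rcons_inj [-> ->] // : rcons u k = rcons (rcons u1 a) b.
    by rewrite -!cats1 ew -catA.
  (* The redex contains the last letter. Letters of h come last in the order, so [a] is in h as
     well, and the rule becomes the module axiom of V. *)
  subst u k; have ha := lt_sub hk ba.
  have IH1 c w : is_sub c -> straighten (u1 ++ [:: c]) w = straighten u1 (hact c w).
    by apply: IH; apply: leq_trans (measure_del u1 a b c [::]) un.
  have [xa xaE] : exists xa : subLie h, val xa = e a.
    by exists (insubd 0 (e a)); rewrite insubdK ?is_subP.
  have [xb xbE] : exists xb : subLie h, val xb = e b.
    by exists (insubd 0 (e b)); rewrite insubdK ?is_subP.
  have -> : lie (e a) (e b) = val (lie xa xb) by rewrite -xaE -xbE.
  rewrite (straighten_ext_sub (fun c => IH1 c v)).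
  have -> : straighten (u1 ++ [:: b; a]) v = straighten u1 (hact b (hact a v)).
    rewrite -IH1 // -[RHS]IH //; first by rewrite -catA.
    by rewrite -catA; apply: leq_trans (measure_swap u1 [::] ba) un.
  rewrite -cats1 IH1 // lact_lie !(hactE _ hk xbE) !(hactE _ ha xaE).
  by rewrite -linearD addrC subrK.
have [eu ek] : u = u1 ++ a :: b :: s /\ k = k'.
  have /rcons_inj [-> ->] // : rcons u k = rcons (u1 ++ a :: b :: s) k'.
  by rewrite -!cats1 ew -catA /= cats1.
subst u k'; rewrite (@straighten_confluent _ u1 a b s _ erefl ba).
have cs t : u1 ++ t ++ rcons s k = (u1 ++ t ++ s) ++ [:: k] by rewrite -cats1 !catA.
rewrite (cs [:: b; a]) IH //; last first.
  by rewrite -(cs [:: b; a]); apply: leq_trans (measure_swap u1 _ ba) un.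
congr (_ + _); apply: lin_ext_eq => c; rewrite (cs [:: c]) IH //.
by rewrite -(cs [:: c]); apply: leq_trans (measure_del u1 a b c _) un.
Qed.

(** Multilinear extension to words in arbitrary elements of g; [u] collects the basis letters
    already chosen. *)
Fixpoint straighten_seq (u : seq K) (s : seq g) (v : V) : V :=
  if s is x :: s' then lin_ext (fun c => straighten_seq (u ++ [:: c]) s' v) x else straighten u v.

Lemma straighten_seq_linear u s : linear (straighten_seq u s).
Proof.
elim: s u => [|x s IH] u a v w /=; first exact: straighten_linear.
by rewrite -lin_ext_linf; apply: lin_ext_eq => c; exact: IH.
Qed.

Lemma straighten_seq_lin u s s' a x y v : straighten_seq u (s ++ (a *: x + y) :: s') v =
  a *: straighten_seq u (s ++ x :: s') v + straighten_seq u (s ++ y :: s') v.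
Proof.
elim: s u => [|z s IH] u /=; first exact: lin_ext_linear.
by rewrite -lin_ext_linf; apply: lin_ext_eq => c; exact: IH.
Qed.

Lemma lin_extB (f f' : K -> V) x : lin_ext (fun k => f k - f' k) x = lin_ext f x - lin_ext f' x.
Proof.
rewrite -[- lin_ext f' x]scaleN1r addrC -lin_ext_linf; apply: lin_ext_eq => k.
by rewrite scaleN1r addrC.
Qed.

Lemma straighten_seq_swap u c d t s v :
  straighten_seq (u ++ c :: d :: t) s v - straighten_seq (u ++ d :: c :: t) s v =
  lin_ext (fun k => straighten_seq (u ++ k :: t) s v) (lie (e c) (e d)).
Proof.
elim: s t => [|y s IH] t /=; first by apply: confluent_swap; exact: straighten_confluent.
rewrite -lin_extB lin_extC; apply: lin_ext_eq => k; rewrite -!catA /= IH.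
by apply: lin_ext_eq => l; rewrite -catA.
Qed.

Lemma lin_ext_lie f x y :
  lin_ext (fun c => lin_ext (fun d => lin_ext f (lie (e c) (e d))) y) x = lin_ext f (lie x y).
Proof.
elim/e_ind: x => [|a k x IH]; first by rewrite lie0l !linear0.
rewrite lin_ext_linear IH lin_extE lie_linearl [RHS]lin_ext_linear; congr (_ *: _ + _).
elim/e_ind: y {IH} => [|b l y IH]; first by rewrite !linear0.
by rewrite lin_ext_linear IH lin_extE lie_linearr [RHS]lin_ext_linear.
Qed.

(** Confluence in the form required of a function of words that descends to U(g). *)
Lemma straighten_seq_lie u s x y s' v :
  straighten_seq u (s ++ x :: y :: s') v - straighten_seq u (s ++ y :: x :: s') v =
  straighten_seq u (s ++ lie x y :: s') v.
Proof.
elim: s u => [|z s IH] u /=; last by rewrite -lin_extB; apply: lin_ext_eq => c; exact: IH.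
rewrite [X in _ - X]lin_extC -lin_extB -lin_ext_lie; apply: lin_ext_eq => c.
rewrite -lin_extB; apply: lin_ext_eq => d.
by rewrite -!catA; exact: straighten_seq_swap.
Qed.

Lemma straighten_seq_rcons u s (x : subLie h) v :
  straighten_seq u (s ++ [:: val x]) v = straighten_seq u s (lact x v).
Proof.
elim: s u => [|y s IH] u /=; last by apply: lin_ext_eq => c; exact: IH.
by apply: straighten_ext_sub => k; exact: straighten_rcons.
Qed.

(** * The retraction of Ind(V) onto V *)

Definition uenv_retract (u : uenv g) (v : V) : V :=
  uenv_word_ext (fun s : seq g => straighten_seq [::] s v) u.

Lemma uenv_retractE p v : uenv_retract (\pi_(uenv g) p) v =
  word_ext (fun s => straighten_seq [::] s v) p.
Proof.
apply: uenv_word_extE => [s s' a x y|s x y s'];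
  [exact: straighten_seq_lin|exact: straighten_seq_lie].
Qed.

Lemma uenv_retract_linearl v : linear (uenv_retract^~ v).
Proof.
apply: uenv_word_ext_linear => [s s' a x y|s x y s'];
  [exact: straighten_seq_lin|exact: straighten_seq_lie].
Qed.

Lemma uenv_retract_linearr u : linear (uenv_retract u).
Proof.
move=> a v w; rewrite -[u]reprK !uenv_retractE; elim/malg_linind: (repr u) => [|b k p IH].
  by rewrite !word_ext0 scaler0 addr0.
rewrite !word_ext_lin IH !word_extU straighten_seq_linear !scalerDr !scalerA [b * a]mulrC.
by rewrite addrACA.
Qed.

Lemma uenv_retract_inj u (x : subLie h) v :
  uenv_retract (u * uinj (val x)) v = uenv_retract u (lact x v).
Proof.
rewrite -[u]reprK /uinj -pi_uenv_mul !uenv_retractE.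
elim/malg_linind: (repr u) => [|b w p IH].
  by rewrite [X in word_ext _ X]mul0r !word_ext0.
apply: etrans (congr1 (word_ext _) (mulZDl _ _ _ _)) _.
apply: etrans (word_ext_lin _ _ _ _) _.
apply: etrans (congr1 (+%R _) IH) (etrans _ (esym (word_ext_lin _ _ _ _))).
congr (_ *: _ + _).
rewrite free_gen.unlock; have -> := malg_mulU w (fmu (val x)).
by rewrite !word_extU fmM fmU straighten_seq_rcons.
Qed.

(** By linearity [b] may be taken to be a word in h; its letters pass to [v] one at a time by
    [uenv_retract_inj]. *)
Lemma uenv_retract_bal u (b : uenv (subLie h)) v :
  uenv_retract (u * uenv_incl b) v = uenv_retract u (uenv_act b v).
Proof.
rewrite -[b]reprK uenv_inclE uenv_actE; move: (repr b) => {b} q.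
have zl w : uenv_retract 0 w = 0.
  by have := uenv_retract_linearl w (-1) 0 0; rewrite scaler0 addr0 scaleN1r addNr.
have zr u' : uenv_retract u' 0 = 0.
  by have := uenv_retract_linearr u' (-1) 0 0; rewrite scaler0 addr0 scaleN1r addNr.
elim/malg_linind: q => [|a w q IH].
  by rewrite [freealg_incl 0]linear0 (linear0 (freealg_act v)) mulr0 zl zr.
rewrite (freealg_incl_lin a erefl erefl) (freealg_act_lin a erefl erefl) mulrDr.
rewrite -scalerAr uenv_retract_linearl IH uenv_retract_linearr.
congr (_ *: _ + _); rewrite freealg_inclU freealg_actU.
elim: (w : seq (subLie h)) u {IH} => [|x s IHs] u; first by rewrite big_nil mulr1.
by rewrite big_cons mulrA IHs uenv_retract_inj.
Qed.

Definition Ind_retract : {malg F[(uenv g * V)%type]} -> V :=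
  linext (fun uv => uenv_retract uv.1 uv.2).
HB.instance Definition _ := GRing.Linear.on Ind_retract.

Lemma Ind_retract_rel r : tensor_rel r -> Ind_retract r = 0.
Proof.
have E u v : Ind_retract << (u, v) >> = uenv_retract u v by exact: linextU.
have L a p q r' P Q R : Ind_retract p = P -> Ind_retract q = Q ->
    Ind_retract r' = R -> P = a *: Q + R -> Ind_retract (p - (a *: q + r')) = 0.
  by move=> fp fq fr pqr; rewrite linearB linearP /= fp fq fr pqr subrr.
case=> [a u u' v|a u v v'|u b v].
- apply: L; [exact: E | exact: E | exact: E |]; exact: uenv_retract_linearl.
- apply: L; [exact: E | exact: E | exact: E |]; exact: uenv_retract_linearr.
- rewrite linearB; apply/eqP; rewrite subr_eq0; apply/eqP.
  by apply: etrans (E _ _) (etrans _ (esym (E _ _))); exact: uenv_retract_bal.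
Qed.

(** The retraction sends [tens 1 v] back to [v], the empty word being straightened already. *)
Lemma tens1_eq0 (v : V) : tens 1 v = 0 :> Ind V -> v = 0.
Proof.
move=> t0.
have /lquot_eqP : \pi_(Ind V) << (1, v) >> == \pi_(Ind V) 0.
  by apply/eqP; rewrite -[LHS]/(tens 1 v) t0; apply/esym; exact: raddf0.
rewrite subr0 => /(lspan_lin0 Ind_retract_rel).
rewrite [LHS]linextU /= -pi_uenv1 uenv_retractE.
by rewrite (word_extU _ mone) fm1 /= straighten0.
Qed.

End Straightening.

(** * Generation of Ind(V) by the image of V *)

Section InducedGeneration.
Variables (F : fieldType) (g : lieAlgType F) (h : lieSubalg g).
Variable V : lieModType (subLie h).

HB.instance Definition _ (u : uenv g) :=
  GRing.isLinear.Build F V (Ind V) _ (tens u) (tens_linr u).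

Lemma Ind_act_wordE (w : {fmonom g}) (v : V) :
  tens (\pi_(uenv g) << w >>) v = foldr (fun x : g => lact x) (tens 1 v : Ind V) w.
Proof.
case: w; elim=> [|x s IH] /=.
  have -> : {| fmonom_val := [::] |} = mone :> {fmonom g} by apply: val_inj; rewrite /= fm1.
  by rewrite -pi_uenv1.
have -> : {| fmonom_val := x :: s |} = mmul (fmu x) {| fmonom_val := s |}.
  by apply: val_inj; rewrite /= fmM fmU.
apply: etrans (etrans (esym (Ind_act_tens x _ v)) (congr1 (Ind_act x) IH)).
apply: (congr1 (fun u : uenv g => tens u v)).
rewrite -(malg_mulU (fmu x) {| fmonom_val := s |}) /uinj free_gen.unlock.
exact: pi_uenv_mul.
Qed.

Lemma Ind_generated (W : Ind V -> Prop) :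
  is_submodule W -> (forall v, W (tens 1 v)) -> forall w, W w.
Proof.
move=> [W0 WD WA] W1; elim/Ind_ind => // a u v w Ww; apply: (WD _ _ _ _ Ww).
rewrite -[u]reprK; elim/malg_linind: (repr u) => [|b k p IH].
  suff -> : tens (\pi_(uenv g) 0) v = 0 :> Ind V by [].
  have -> : \pi_(uenv g) 0 = 0 :> uenv g by exact: raddf0.
  by have := tens_linl v (-1) 0 0; rewrite scaler0 addr0 scaleN1r addNr.
rewrite pi_lquot_linear tens_linl; apply: (WD _ _ _ _ IH).
rewrite Ind_act_wordE; elim: (k : seq g) => [|x s IHs] /=; first exact: W1.
exact: WA.
Qed.

End InducedGeneration.

(** * The induced module of the Schrodinger-Virasoro algebra is nonzero *)

HB.instance Definition _ := Countable.copy svbasis (can_type svbasis_codeK).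

Section Letters.
Variables d1 d2 : nat.

Definition sub_letter (b : svbasis) : bool := match b with
  | bL m => 0 <= m
  | bM m => - d1%:Z <= m
  | bY m => 0 < m + d2%:Z
  | bC => true
  end.

(** Letters outside of the subalgebra come first, as straightening demands; [pickle] supplies an
    arbitrary total order within each of the two classes. *)
Definition letter_lt : rel svbasis := fun a b =>
  if sub_letter a == sub_letter b then (pickle a < pickle b)%N else ~~ sub_letter a.

Lemma letter_lt_irr : irreflexive letter_lt.
Proof. by move=> a; rewrite /letter_lt eqxx ltnn. Qed.

Lemma letter_lt_trans : transitive letter_lt.
Proof.
move=> b a c; rewrite /letter_lt.
by case: (sub_letter a) (sub_letter b) (sub_letter c) => [] [] [] //=; exact: ltn_trans.
Qed.

Lemma letter_lt_total a b : a != b -> letter_lt a b || letter_lt b a.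
Proof.
move=> ab; rewrite /letter_lt [sub_letter b == _]eq_sym.
case: eqP => [_|]; last by case: (sub_letter a) (sub_letter b) => [] [].
by rewrite -neq_ltn; apply: contra_neq ab => /(pcan_inj pickleK).
Qed.

Lemma letter_lt_sub a b : sub_letter a -> letter_lt a b -> sub_letter b.
Proof. by rewrite /letter_lt => ->; case: (sub_letter b). Qed.

End Letters.

Section InducedNonzero.
Variables (F : numFieldType) (lam mu : F) (d1 d2 : nat).
Variable hd : 2 * d2%:Z - 1 <= d1%:Z.
Local Notation svb := (@sv_basis F lam mu).
Variable V : lieModType (SVsub lam mu hd).

Definition sv_coord (x : SV lam mu) : {malg F[svbasis]} := x.
Fact sv_coord_linear : linear sv_coord. Proof. by []. Qed.
HB.instance Definition _ :=
  GRing.isLinear.Build F (SV lam mu) {malg F[svbasis]} _ sv_coord sv_coord_linear.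

Lemma svsub_gen_letter (x : SV lam mu) :
  svsub_gen d1 d2 x <-> exists2 b, sub_letter d1 d2 b & x = svb b.
Proof.
split=> [[->|[i ->]|[i ->]|[i [i0 ->]]]|[[m|m|m|] /= hm ->]].
- by exists bC.
- by exists (bM (i%:Z - d1%:Z)) => //=; lia.
- by exists (bL i%:Z).
- by exists (bY (i%:Z - d2%:Z)) => //=; lia.
- by apply: Or43; exists (absz m); congr svL; lia.
- by apply: Or42; exists (absz (m + d1%:Z)%R); congr svM; lia.
- by apply: Or44; exists (absz (m + d2%:Z)%R); split; [lia|congr svY; lia].
- exact: Or41.
Qed.

Lemma sub_letterP b : sub_letter d1 d2 b ->
  svb b \in lieSubalg_set (svsub lam mu hd).
Proof.
by move=> hb; apply/lspan_predP/lspan_gen/svsub_gen_letter; exists b.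
Qed.

Lemma svsub_ind (P : SVsub lam mu hd -> Prop) : P 0 ->
  (forall a b (x y : SVsub lam mu hd), sub_letter d1 d2 b -> val x = svb b -> P y ->
     P (a *: x + y)) -> forall x, P x.
Proof.
move=> P0 PD x.
suff PS y : lspan (@svsub_gen F lam mu d1 d2) y -> forall x : SVsub lam mu hd, val x = y -> P x.
  by apply: (PS (val x)) => //; apply/lspan_predP; exact: (valP x).
elim=> [|a u w /svsub_gen_letter [b hb eu] Sw IH] {}x xE.
  by have -> : x = 0 by apply: val_inj; rewrite xE linear0.
pose xb : SVsub lam mu hd := exist _ (svb b) (sub_letterP hb).
pose xw : SVsub lam mu hd := exist _ w (introT (lspan_predP _ _) Sw).
have -> : x = a *: xb + xw by apply: val_inj; rewrite linearP /= xE eu.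
by apply: (PD _ b) => //; exact: IH.
Qed.

Lemma sv_tens1_eq0 (v : V) : tens 1 v = 0 :> Ind V -> v = 0.
Proof.
apply: (@tens1_eq0 _ _ _ V _ svb sv_coord _ _ _ _ (@letter_lt_irr d1 d2)
  (@letter_lt_trans d1 d2) (@letter_lt_total d1 d2) (@letter_lt_sub d1 d2) sub_letterP svsub_ind).
- by move=> k; rewrite sv_basis.unlock.
- exact: SV_ind.
Qed.

End InducedNonzero.

(** * The degree filtration *)

Section Span.
Variables (F : fieldType) (V : lmodType F) (S : V -> Prop).

Lemma lspanZ a u : lspan S u -> lspan S (a *: u).
Proof. by move=> Su; rewrite -[_ *: _]addr0; apply: lspan_lin => //; exact: lspan0. Qed.

Lemma lspanD u v : lspan S u -> lspan S v -> lspan S (u + v).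
Proof. by move=> Su Sv; rewrite -[u]scale1r; exact: lspan_lin. Qed.

Lemma lspanN u : lspan S u -> lspan S (- u).
Proof. by move=> Su; rewrite -scaleN1r; exact: lspanZ. Qed.

Lemma lspanB u v : lspan S u -> lspan S v -> lspan S (u - v).
Proof. by move=> Su Sv; apply: lspanD => //; exact: lspanN. Qed.

Lemma lspan_sub (S' : V -> Prop) u : (forall v, S v -> lspan S' v) -> lspan S u -> lspan S' u.
Proof. by move=> SS'; elim=> [|a v w Sv _ IH]; [exact: lspan0|apply: lspan_lin => //; exact: SS']. Qed.

Lemma lspan_sum (I : Type) (r : seq I) (P : pred I) (f : I -> V) :
  (forall i, P i -> lspan S (f i)) -> lspan S (\sum_(i <- r | P i) f i).
Proof.
by move=> Sf; elim/big_ind: _ => //; [exact: lspan0|exact: lspanD].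
Qed.

End Span.

Section Degree.
Variables (F : numFieldType) (lam mu : F) (d1 d2 : nat).
Variable t : nat.
Local Notation svb := (@sv_basis F lam mu).
Local Notation is_sub := (sub_letter d1 d2).

(* With d = 4i + 4, 4i - 3, 4i - 1 for L_{-i}, M_{-d1-i}, Y_{-d2-i+1/2} and -d for the
   dual letters M_{t+i}, L_{t+d1+i}, Y_{t+d2+i-1/2}, the bracket with a dual letter drops
   the degree by at least 1 more than d, except for the letter paired with it; the three
   offsets are tuned so that this also holds when d1 = 2 d2 - 1 or t = d1 = 0. *)
Definition letter_deg (b : svbasis) : int := match b with
  | bL m => if m < 0 then 4 - 4 * m
            else if m <= t%:Z + d1%:Z then 0 else 3 - 4 * (m - t%:Z - d1%:Z)
  | bM m => if m < - d1%:Z then - 4 * (m + d1%:Z) - 3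
            else if m <= t%:Z then 0 else - 4 - 4 * (m - t%:Z)
  | bY m => if m <= - d2%:Z then 4 * (1 - d2%:Z - m) - 1
            else if m <= t%:Z + d2%:Z then 0 else 1 - 4 * (m - t%:Z - d2%:Z)
  | bC => 0
  end.

(** The indices are chosen so that the bracket of the pair lies in the line of M_t; the shift by 1
    for Y is the one in [Y_{m-1/2}, Y_{n-1/2}] = (m-n) M_{m+n-1}. The entry for C is a filler. *)
Definition dual_letter (b : svbasis) : svbasis := match b with
  | bL m => bM (t%:Z - m)
  | bM m => bL (t%:Z - m)
  | bY m => bY (t%:Z + 1 - m)
  | bC => bC
  end.

Definition dual_coef (b : svbasis) : F := match b with
  | bL m => - ((t%:Z - m)%:~R - lam * m%:~R + 2 * mu)
  | bM m => m%:~R - lam * (t%:Z - m)%:~R + 2 * mu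
  | bY m => (t%:Z + 1 - m - m)%:~R
  | bC => 0
  end.

Definition sv_deg_le (n : int) (x : SV lam mu) : Prop :=
  lspan (fun y => exists2 b, letter_deg b <= n & y = svb b) x.

Lemma sv_deg_leZ n a b : letter_deg b <= n -> sv_deg_le n (a *: svb b).
Proof. by move=> bn; apply/lspanZ/lspan_gen; exists b. Qed.

Lemma letter_deg_gt0 b : ~~ is_sub b -> 0 < letter_deg b.
Proof. by case: b => [m|m|m|] //= hm; repeat case: ifP; lia. Qed.

Lemma letter_deg_le0 b : is_sub b -> letter_deg b <= 0.
Proof. by case: b => [m|m|m|] //= hm; repeat case: ifP; lia. Qed.

Lemma dual_bracket b : ~~ is_sub b ->
  lie (svb (dual_letter b)) (svb b) = dual_coef b *: svM t%:Z.
Proof.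
case: b => [m|m|m|] //= hm; rewrite [LHS]sv_lieU /=.
- by rewrite /sv_bracketLM scaleNr [m + _]addrC subrK.
- by rewrite /sv_bracketLM subrK.
- by rewrite /sv_bracketYY; congr (_ *: svM _); lia.
Qed.

(** All letters that can occur in the bracket, whatever their coefficients, so that degree bounds
    become integer inequalities. *)
Definition bracket_letters (a b : svbasis) : seq svbasis := match a, b with
  | bL i, bL j => bL (i + j) :: nseq (i + j == 0) bC
  | bL i, bM j | bM i, bL j => [:: bM (i + j)]
  | bL i, bY j | bY i, bL j => [:: bY (i + j)]
  | bY i, bY j => [:: bM (i + j - 1)]
  | _, _ => [::]
  end.

Lemma bracket_deg n a b :
  {in bracket_letters a b, forall c, letter_deg c <= n} ->
  sv_deg_le n (lie (svb a) (svb b)).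
Proof.
case: a b => [i|i|i|] [j|j|j|] H; rewrite [lie _ _]sv_lieU /=;
  try exact: lspan0; try apply: lspanN;
  try by apply: sv_deg_leZ; apply: H; rewrite inE // addrC.
apply: lspanD; first by apply: sv_deg_leZ; apply: H; rewrite inE eqxx.
case: eqP H => [ij|ij] H; last by rewrite mul0r scale0r; exact: lspan0.
by apply: sv_deg_leZ; apply: H; rewrite /= ij !inE eqxx orbT.
Qed.

Lemma bracket_deg_Mt b : ~~ is_sub b ->
  sv_deg_le (letter_deg b - 1) (lie (svM t%:Z) (svb b)).
Proof.
move=> hb; apply: bracket_deg => c.
case: b hb => [j|j|j|] //= hb; rewrite inE => /eqP -> /=; repeat case: ifP; lia.
Qed.

Lemma dual_letter_deg a : ~~ is_sub a -> letter_deg (dual_letter a) = - letter_deg a.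
Proof.
by case: a => [i|i|i|] //= hi; repeat case: ifP; lia.
Qed.

(** Up to sign, the coefficient of L_{-i} is the first factor of the hypothesis and that of
    M_{-d1-i} the second; for Y it is t + 1 - 2m with m <= -d2 <= 0, hence positive. *)
Lemma dual_coef_neq0 a : ~~ is_sub a ->
  (forall i : nat, (0 < i)%N ->
     ((lam + 1) * i%:R + t%:R + 2 * mu)
     * (i%:R + d1%:R + lam * (i%:R + t%:R + d1%:R) - 2 * mu) != 0) ->
  dual_coef a != 0.
Proof.
move=> ha hc; case: a ha => [m|m|m|] //= hm.
- have [i i0 ->] : exists2 i : nat, (0 < i)%N & m = - i%:Z by exists (absz m); lia.
  have := hc _ i0; rewrite mulf_eq0 negb_or => /andP [+ _].
  apply: contra_neq => E; rewrite -[RHS]oppr0 -E; ring.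
- have [i i0 ->] : exists2 i : nat, (0 < i)%N & m = - d1%:Z - i%:Z.
    by exists (absz (m + d1%:Z)%R); lia.
  have := hc _ i0; rewrite mulf_eq0 negb_or => /andP [_].
  apply: contra_neq => E; rewrite -[RHS]oppr0 -E; ring.
- by rewrite intr_eq0; lia.
Qed.

Hypothesis hd : 2 * d2%:Z - 1 <= d1%:Z.

Lemma bracket_deg_le a b : ~~ is_sub b ->
  sv_deg_le (letter_deg a + letter_deg b) (lie (svb a) (svb b)).
Proof.
move=> hb; apply: bracket_deg => c.
case: a b hb => [i|i|i|] [j|j|j|] //= hb; rewrite inE ?mem_nseq; try move=> /orP [];
  try (rewrite lt0b => /andP [/eqP ij]); move=> /eqP -> /=; repeat case: ifP; lia.
Qed.

(** Two letters Y are the tight case: if M_{i+j-1} is outside of the subalgebra, the bound on its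
    degree says exactly d1 >= 2 d2 - 1. *)
Lemma bracket_deg_lt a b : ~~ is_sub a -> ~~ is_sub b ->
  sv_deg_le (letter_deg a + letter_deg b - 1) (lie (svb a) (svb b)).
Proof.
move=> ha hb; apply: bracket_deg => c.
case: a b ha hb => [i|i|i|] [j|j|j|] //= ha hb; rewrite inE ?mem_nseq; try move=> /orP [];
  try (rewrite lt0b => /andP [/eqP ij]); move=> /eqP -> /=; repeat case: ifP; lia.
Qed.

(** For [b = a] the bracket is a multiple of M_t, of degree exactly 0; every other pair loses at
    least one degree more and vanishes on the graded space. *)
Lemma bracket_deg_dual a b : ~~ is_sub a -> ~~ is_sub b -> b != a ->
  sv_deg_le (letter_deg b - letter_deg a - 1) (lie (svb (dual_letter a)) (svb b)).
Proof.
move=> ha hb ab; apply: bracket_deg => c.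
case: a b ha hb ab => [i|i|i|] [j|j|j|] //= ha hb ab; rewrite inE ?mem_nseq; try move=> /orP [];
  try (have ji : j <> i by (move=> ji; rewrite ji eqxx in ab)); clear ab;
  try (rewrite lt0b => /andP [/eqP ij]); move=> /eqP -> /=; repeat case: ifP; lia.
Qed.

End Degree.

(** * The filtered module and the action on its graded space *)

Section Filtration.
Variables (F : numFieldType) (lam mu : F) (d1 d2 : nat).
Variable hd : 2 * d2%:Z - 1 <= d1%:Z.
Variable t : nat.
Variable V : lieModType (SVsub lam mu hd).
Variables (I : lieModType (SV lam mu)) (iota : {linear V -> I}).
Hypothesis iota_act : forall (x : SVsub lam mu hd) v,
  lact (val x) (iota v) = iota (lact x v).
Local Notation svb := (@sv_basis F lam mu).
Local Notation is_sub := (sub_letter d1 d2).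
Local Notation neg s := (all (predC is_sub) s).
Local Notation deg := (letter_deg d1 d2 t).
Local Notation deg_le := (sv_deg_le d1 d2 t).
Hypothesis deg_lt0_act : forall b (x : SVsub lam mu hd) (v : V),
  deg b < 0 -> val x = svb b -> lact x v = 0.
Variable xt : SVsub lam mu hd.
Hypothesis xtE : val xt = svM t%:Z.

Implicit Types (s m : seq svbasis) (v : V) (w : I) (n : int).

Definition word_act s v : I := foldr (fun b => lact (svb b)) (iota v) s.
Definition word_deg s : int := \sum_(b <- s) deg b.

(** Words are taken in any order; by [word_act_perm] reordering changes them by lower terms only. *)
Definition Fil n : I -> Prop :=
  lspan (fun w => exists s v, [/\ neg s, word_deg s <= n & w = word_act s v]).

Lemma word_deg_cons b s : word_deg (b :: s) = deg b + word_deg s.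
Proof. by rewrite /word_deg big_cons. Qed.

Lemma word_deg_ge0 s : neg s -> 0 <= word_deg s.
Proof.
move=> /allP ns; rewrite /word_deg big_seq; apply: sumr_ge0 => b /ns /=.
by move=> hb; apply/ltW/letter_deg_gt0.
Qed.

Lemma word_act_linear s : linear (word_act s).
Proof.
elim: s => [|b s IH] a u v; first exact: linearP.
by rewrite /= IH lact_linearr.
Qed.

HB.instance Definition _ s := GRing.isLinear.Build F V I _ (word_act s) (word_act_linear s).

Lemma Fil_word n s v : neg s -> word_deg s <= n -> Fil n (word_act s v).
Proof. by move=> ns sn; apply: lspan_gen; exists s, v. Qed.

Lemma Fil_mono n (m : int) w : n <= m -> Fil n w -> Fil m w.
Proof.
move=> nm; apply: lspan_sub => _ [s [v [ns sn ->]]].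
by apply: Fil_word => //; exact: le_trans nm.
Qed.

(** Letters outside of the subalgebra have positive degree, so no word has negative degree. *)
Lemma Fil_lt0 n w : n < 0 -> Fil n w -> w = 0.
Proof.
move=> n0; elim=> [|a _ w' [s [v [ns sn ->]]] _ ->] //.
by have := word_deg_ge0 ns; lia.
Qed.

Lemma Fil_lact n (m : int) (x : SV lam mu) w :
  (forall s v, neg s -> Fil (n + word_deg s) (lact x (word_act s v))) ->
  Fil m w -> Fil (n + m) (lact x w).
Proof.
move=> H; elim=> [|a _ w' [s [v [ns sm ->]]] _ IH].
  by rewrite linear0; exact: lspan0.
rewrite lact_linearr; apply: lspan_lin => //.
by apply: Fil_mono (H s v ns); lia.
Qed.

Lemma Fil_neg b n w : ~~ is_sub b -> Fil n w -> Fil (deg b + n) (lact (svb b) w).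
Proof.
move=> hb; apply: Fil_lact => s v ns; rewrite -word_deg_cons.
by apply: (@Fil_word _ (b :: s)) => //=; rewrite hb.
Qed.

Lemma lactZr (x : SV lam mu) a w : lact x (a *: w) = a *: lact x w.
Proof. exact: linearZ. Qed.

Lemma lact_swap (x y : SV lam mu) w :
  lact x (lact y w) = lact y (lact x w) + lact (lie x y) w.
Proof. by rewrite lact_lie addrC subrK. Qed.

Lemma Fil_deg_le_word n (x : SV lam mu) s v :
  (forall b, Fil (deg b + word_deg s) (lact (svb b) (word_act s v))) ->
  deg_le n x -> Fil (n + word_deg s) (lact x (word_act s v)).
Proof.
move=> H; elim=> [|a _ y [b bn ->] _ IH]; first by rewrite lact0; exact: lspan0.
rewrite lact_lin; apply: lspan_lin => //; by apply: Fil_mono (H b); lia.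
Qed.

(** The letter is commuted to the right by [bracket_deg_le]. Once it reaches V, a letter of the
    subalgebra acts within V if its degree is 0 and as zero if its degree is negative. *)
Lemma Fil_letter_word b s v : neg s ->
  Fil (deg b + word_deg s) (lact (svb b) (word_act s v)).
Proof.
elim: s b => [|c s IH] b ns.
  have [hb|hb] := boolP (is_sub b); last exact: Fil_neg (Fil_word _ _ _).
  pose xb : SVsub lam mu hd := exist _ (svb b) (sub_letterP lam mu hd hb).
  rewrite -[svb b]/(val xb) iota_act.
  have := letter_deg_le0 t hb; rewrite le_eqVlt => /orP [/eqP e|b0].
    by rewrite e add0r; exact: (@Fil_word _ [::]).
  by rewrite (@deg_lt0_act b) // linear0; exact: lspan0.
move: ns => /= /andP [hc ns]; rewrite lact_swap word_deg_cons.
apply: lspanD.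
  by rewrite addrCA; apply: Fil_neg => //; exact: IH.
rewrite addrA; apply: Fil_deg_le_word; first by move=> b'; exact: IH.
exact: bracket_deg_le.
Qed.


Lemma Fil_letter b n w : Fil n w -> Fil (deg b + n) (lact (svb b) w).
Proof. by apply: Fil_lact => s v; exact: Fil_letter_word. Qed.

Lemma Fil_deg_le n (m : int) (x : SV lam mu) w : deg_le n x -> Fil m w -> Fil (n + m) (lact x w).
Proof.
move=> nx; apply: Fil_lact => s v ns; apply: Fil_deg_le_word nx => b.
exact: Fil_letter_word.
Qed.

Lemma word_act_move u a s v : neg (u ++ a :: s) ->
  Fil (word_deg (u ++ a :: s) - 1) (word_act (u ++ a :: s) v - word_act (a :: u ++ s) v).
Proof.
elim: u => [|b u IH] /=; first by rewrite subrr => _; exact: lspan0.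
move=> /andP [hb nus]; rewrite (lact_swap (svb a)) opprD addrA -linearB.
have [ha nu] : ~~ is_sub a /\ neg (u ++ s).
  by move: nus; rewrite !all_cat /= => /and3P [-> ->].
have E : word_deg (u ++ a :: s) = deg a + word_deg (u ++ s).
  by rewrite /word_deg !big_cat big_cons /= addrCA.
rewrite word_deg_cons; apply: lspanB.
  by rewrite -addrA; apply: Fil_letter; exact: IH.
by apply: Fil_mono (Fil_deg_le (bracket_deg_lt lam mu t hd ha hb) (Fil_word v nu (lexx _))); lia.
Qed.

Lemma word_deg_perm s s' : perm_eq s s' -> word_deg s = word_deg s'.
Proof. exact: perm_big. Qed.

(** Letters commute up to lower degree: the head of [s] is brought to the front of [s'] by
    [word_act_move], then induction applies to the tails. *)
Lemma word_act_perm s s' v : neg s -> perm_eq s s' ->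
  Fil (word_deg s - 1) (word_act s v - word_act s' v).
Proof.
elim: s s' => [|a s IH] s' /=.
  by move=> _; rewrite perm_sym => /perm_nilP ->; rewrite subrr; exact: lspan0.
move=> /andP [ha ns] ss'.
have [u [u' es']] : exists u u', s' = u ++ a :: u'.
  have : a \in s' by rewrite -(perm_mem ss') mem_head.
  by case/splitPr => u u'; exists u, u'.
have ss : perm_eq s (u ++ u').
  rewrite -(perm_cons a); apply: perm_trans ss' _.
  by rewrite es' -[a :: u']cat1s -[a :: (u ++ u')]cat1s perm_catCA.
have ns' : neg s' by rewrite -(perm_all _ ss') /= ha.
rewrite -(subrKA (lact (svb a) (word_act (u ++ u') v))) -linearB.
apply: lspanD; first by rewrite word_deg_cons -addrA; apply: Fil_neg => //; exact: IH.
rewrite -[X in lspan _ X]opprB; apply: lspanN; rewrite (word_deg_perm (s := a :: s) ss') es'.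
by apply: word_act_move; rewrite -es'.
Qed.

Lemma word_act_Mt s v : neg s ->
  Fil (word_deg s - 1) (lact (svM t%:Z) (word_act s v) - word_act s (lact xt v)).
Proof.
elim: s => [|b s IH] /=.
  by rewrite -xtE iota_act subrr => _; exact: lspan0.
move=> /andP [hb ns]; rewrite lact_swap addrAC -linearB word_deg_cons.
apply: lspanD; first by rewrite -addrA; apply: Fil_neg => //; exact: IH.
by apply: Fil_mono (Fil_deg_le (bracket_deg_Mt lam mu t hb) (Fil_word v ns (lexx _))); lia.
Qed.

(* The dual letter acts on the associated graded module as a derivation in a,
   up to a nonzero scalar and the commuting action of M_t. *)
Lemma dual_word_act a s v : ~~ is_sub a -> neg s ->
  Fil (word_deg s - deg a - 1)
    (lact (svb (dual_letter t a)) (word_act s v)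
     - (dual_coef lam mu t a * (count_mem a s)%:R) *: word_act (rem a s) (lact xt v)).
Proof.
move=> ha; elim: s => [|b s IH] ns.
  (* The dual letter has negative degree, so it kills the image of V. *)
  rewrite mulr0 scale0r subr0 -[word_deg _]addr0 addrC.
  have D0 : word_deg [::] = 0 by rewrite /word_deg big_nil.
  have := Fil_letter_word (dual_letter t a) v (s := [::]) isT.
  rewrite D0 addr0 dual_letter_deg //= => /Fil_lt0 ->; first exact: lspan0.
  by have := letter_deg_gt0 t ha; lia.
move: ns => /= /andP [hb ns]; have {IH} := IH ns; set k := dual_coef _ _ _ _ => IH.
rewrite lact_swap word_deg_cons.
(* For [b] different from [a] the bracket with the dual letter falls into lower degree; for [b = a]
   it contributes one more M_t term and raises the multiplicity by 1. *)
have [ba|ba] := eqVneq b a; last first.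
  rewrite /= add0n [X in Fil _ X]addrAC -lactZr -linearB; apply: lspanD.
    by apply: Fil_mono (Fil_neg hb IH); lia.
  by apply: Fil_mono (Fil_deg_le (bracket_deg_dual lam mu t hd ha hb ba)
    (Fil_word v ns (lexx _))); lia.
subst b; rewrite (dual_bracket lam mu t ha) lactZ /= add1n -addn1 natrD mulrDr mulr1.
rewrite -/k; set z := word_act s (lact xt v).
set kc := k * _; set z' := word_act (rem a s) (lact xt v) in IH *.
have -> : lact (svb a) (lact (svb (dual_letter t a)) (word_act s v))
    + k *: lact (svM t%:Z) (word_act s v) - (kc + k) *: z
  = lact (svb a) (lact (svb (dual_letter t a)) (word_act s v) - kc *: z')
    + (kc *: (lact (svb a) z' - z) + k *: (lact (svM t%:Z) (word_act s v) - z)).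
  rewrite linearB /= lactZr !scalerBr [RHS]addrA subrKA [RHS]addrACA.
  by rewrite -opprD scalerDl.
apply: lspanD; first by apply: Fil_mono (Fil_neg ha IH); lia.
apply: lspanD; last by apply/lspanZ/(Fil_mono _ (word_act_Mt v ns)); lia.
(* [kc] vanishes unless [a] occurs in [s], and then [a] followed by the rest is a reordering of
   [s]. *)
have [sa|/count_memPn c0] := boolP (a \in s); last first.
  by rewrite /kc c0 mulr0 scale0r; exact: lspan0.
apply: lspanZ; rewrite -[X in lspan _ X]opprB; apply: lspanN.
apply: (@Fil_mono (word_deg s - 1)); first by lia.
exact: word_act_perm (perm_to_rem sa).
Qed.

(** * Lowering leading words into the image of V *)

Definition Mt_pow (k : nat) v : V := iter k (lact xt) v.

Lemma Mt_pow_linear k : linear (Mt_pow k).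
Proof. by elim: k => [|k IH] a u v //; rewrite /Mt_pow !iterS -!/(Mt_pow k _) IH lact_linearr. Qed.
HB.instance Definition _ k := GRing.isLinear.Build F V V _ (Mt_pow k) (Mt_pow_linear k).

Definition lower m w : I :=
  foldl (fun w a => lact (svb (dual_letter t a)) w) w m.

Lemma lower_linear m : linear (lower m).
Proof. by elim: m => [|a m IH] b u w //=; rewrite lact_linearr IH. Qed.
HB.instance Definition _ m := GRing.isLinear.Build F I I _ (lower m) (lower_linear m).

Hypothesis dual_neq0 : forall a, ~~ is_sub a -> dual_coef lam mu t a != 0.

(** Iterated differentiation of a monomial: differentiating by all letters of [m] detects [m] among
    the monomials of at most its degree, and each letter leaves one factor M_t. *)
Lemma lower_word m : neg m -> exists2 k : F, k != 0 & forall s v, neg s ->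
  word_deg s <= word_deg m ->
  lower m (word_act s v) = if perm_eq s m then k *: iota (Mt_pow (size m) v) else 0.
Proof.
elim: m => [|a m IH].
  exists 1; first exact: oner_neq0.
  move=> [|b s] v; first by rewrite scale1r.
  move=> /= /andP [hb ns]; rewrite word_deg_cons {2}/word_deg big_nil.
  by have := letter_deg_gt0 t hb; have := word_deg_ge0 ns; lia.
move=> /= /andP [ha nm]; have [k k0 {}IH] := IH nm.
(* In total this is the product of the dual coefficients and the factorials of the multiplicities,
   nonzero in characteristic 0. *)
exists (dual_coef lam mu t a * (count_mem a (a :: m))%:R * k).
  by rewrite !mulf_neq0 ?dual_neq0 //= eqxx pnatr_eq0.
move=> s v ns; rewrite word_deg_cons => sm.
(* Disposes of error terms: a word of smaller degree than [m] is no rearrangement of [m]. *)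
have lower_Fil w : Fil (word_deg m - 1) w -> lower m w = 0.
  elim=> [|b _ w' [s' [v' [ns' sm' ->]]] _ IHw]; first exact: linear0.
  rewrite lower_linear IHw addr0 IH //; last by lia.
  case: ifP => [/word_deg_perm|]; last by rewrite scaler0.
  by lia.
have := dual_word_act v ha ns; set w := (X in Fil _ X) => Fw.
have /lower_Fil w0 : Fil (word_deg m - 1) w by apply: Fil_mono Fw; lia.
rewrite -[LHS]/(lower m (lact (svb (dual_letter t a)) (word_act s v))) -(subrK ((dual_coef lam mu t a * (count_mem a s)%:R) *:
   word_act (rem a s) (lact xt v)) (lact _ _)) -/w linearD /= w0 add0r linearZ /=.
have [sa|sa] := boolP (a \in s); last first.
  rewrite (count_memPn sa) mulr0 scale0r; case: ifP => // /perm_mem E.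
  by rewrite E mem_head in sa.
have ps := perm_to_rem sa.
have nr : neg (rem a s) by move: ns; rewrite (perm_all _ ps) /= => /andP [].
rewrite IH //; last by move: sm; rewrite (word_deg_perm ps) word_deg_cons; lia.
have -> : perm_eq (rem a s) m = perm_eq s (a :: m).
  by rewrite (permPl ps) perm_cons.
case: ifP => [sam|_]; last by rewrite scaler0.
by rewrite scalerA /Mt_pow -iterSr /= (permP sam).
Qed.

Lemma lower_Fil n m w : neg m -> n < word_deg m -> Fil n w -> lower m w = 0.
Proof.
move=> nm nlt; have [k k0 H] := lower_word nm.
elim=> [|b _ w' [s' [v' [ns' sm' ->]]] _ IHw]; first exact: linear0.
rewrite lower_linear IHw addr0 H //; last by lia.
case: ifP => [/word_deg_perm|]; last by rewrite scaler0.
by lia.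
Qed.

Hypothesis Mt_inj : injective (lact xt : V -> V).

Definition word_sum (l : seq (seq svbasis * V)) : I := \sum_(p <- l) word_act p.1 p.2.

(** A formal sum may cancel in its top degree. The words are treated one permutation class at a
    time, by induction on their number. *)
Lemma word_sum_lower (n : int) (l : seq (seq svbasis * V)) :
  all (fun p => neg p.1 && (word_deg p.1 <= n)) l ->
  Fil (n - 1) (word_sum l) \/
  exists m v, [/\ neg m, word_deg m = n, v != 0 & lower m (word_sum l) = iota v].
Proof.
have [k] := ubnP (size l); elim: k l => // k IH [|[s v] l] /=.
  by move=> _ _; left; rewrite /word_sum big_nil; exact: lspan0.
rewrite ltnS => lk /andP [/andP [ns sn] nl].
have [sn'|sn'] := eqVneq (word_deg s) n; last first.
  have Fs : Fil (n - 1) (word_act s v) by apply: Fil_word => //; lia.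
  rewrite /word_sum big_cons -/(word_sum l) /=.
  have [Fl|[m [v' [nm mn v0 Tm]]]] := IH l lk nl; first by left; exact: lspanD.
  right; exists m, v'; split=> //.
  by rewrite linearD /= (lower_Fil nm _ Fs) ?add0r // mn; lia.
pose P := fun p : seq svbasis * V => perm_eq p.1 s.
pose l2 := [seq p <- l | ~~ P p].
pose u := \sum_(p <- (s, v) :: l | P p) p.2.
have Ew : word_sum ((s, v) :: l) = \sum_(p <- (s, v) :: l | P p) word_act p.1 p.2 + word_sum l2.
  have Psv : P (s, v) by exact: perm_refl.
  by rewrite /word_sum /l2 big_filter (bigID P) /=; congr (_ + _); rewrite big_cons Psv.
have nL : all (fun p => neg p.1 && (word_deg p.1 <= n)) ((s, v) :: l).
  by rewrite /= ns sn.
(* [u] is the total coefficient of the class of [s]. If it is nonzero, lowering by [s] kills the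
   other classes and leaves a nonzero multiple of a power of M_t applied to [u], which is nonzero by
   injectivity. *)
have [u0|u0] := eqVneq u 0; last first.
  have [c c0 H] := lower_word ns.
  right; exists s, (c *: Mt_pow (size s) u); split => //.
    rewrite scaler_eq0 negb_or c0 /=; apply: contra_neq u0.
    elim: (size s) => // k' IHk /=; rewrite -[RHS](linear0 (lact xt)).
    by move/Mt_inj => /IHk.
  rewrite linearZ linear_sum /= /word_sum linear_sum big_seq.
  under eq_bigr => p pL.
    have /andP [np pn] := allP nL p pL.
    rewrite H ?sn' //; over.
  rewrite -big_seq -big_mkcond /u linear_sum scaler_sumr.
  exact: eq_bigr.
(* If [u = 0], replacing each word of the class by [s] costs only lower terms and gives the sum 0,
   so the class can be discarded. *)
have F1 : Fil (n - 1) (\sum_(p <- (s, v) :: l | P p) word_act p.1 p.2).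
  have -> : \sum_(p <- (s, v) :: l | P p) word_act p.1 p.2 =
      \sum_(p <- (s, v) :: l | P p) (word_act p.1 p.2 - word_act s p.2).
    by rewrite sumrB -(linear_sum (word_act s)) -/u u0 linear0 subr0.
  rewrite big_seq_cond; apply: lspan_sum => p /andP [pL Pp].
  have /andP [np pn] := allP nL p pL.
  by apply: Fil_mono (word_act_perm p.2 np Pp); lia.
rewrite Ew; have [||Fl|[m [v' [nm mn v0 Tm]]]] := IH l2 _ _.
- by apply: leq_trans lk; rewrite ltnS size_filter count_size.
- by rewrite /l2 all_filter; apply: sub_all nl => p pn; apply/implyP.
- by left; exact: lspanD.
right; exists m, v'; split=> //.
by rewrite linearD /= (lower_Fil nm _ F1) ?add0r // mn; lia.
Qed.

Lemma Fil_word_sum n w : Fil n w ->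
  exists2 l, all (fun p => neg p.1 && (word_deg p.1 <= n)) l & w = word_sum l.
Proof.
elim=> [|a _ w' [s [v [ns sn ->]]] _ [l nl ->]].
  by exists [::] => //; rewrite /word_sum big_nil.
exists ((s, a *: v) :: l); first by rewrite /= ns sn.
by rewrite /word_sum big_cons /= [word_act s (a *: v)]linearZ.
Qed.

Lemma Fil_lower n w : Fil n w -> w != 0 ->
  exists m v, v != 0 /\ lower m w = iota v.
Proof.
(* The shift by 1 lets the measure still decrease from n = 0 to n = -1, where the filtration is
   zero. *)
have [k] := ubnP (absz (n + 1)%R); elim: k n => // k IH n nk Fw w0.
have [n0|n0] := ltP n 0; first by rewrite (Fil_lt0 n0 Fw) eqxx in w0.
have [l nl El] := Fil_word_sum Fw.
have [Fw'|[m [v [_ _ v0 H]]]] := word_sum_lower nl; last by exists m, v; rewrite El.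
by apply: IH w0; [|rewrite El; exact: Fw']; lia.
Qed.

(** * Submodules and nilpotency from the filtration *)

Hypothesis I_generated : forall W : I -> Prop, is_submodule W ->
  (forall v, W (iota v)) -> forall w, W w.

(** The union of the filtration is a submodule containing the image of V, so it is everything. *)
Lemma Fil_exists w : exists n, Fil n w.
Proof.
move: w; apply: I_generated; last first.
  by move=> v; exists 0; apply: (@Fil_word _ [::]) => //; rewrite /word_deg big_nil.
split; first by exists 0; exact: lspan0.
  move=> a u v [n Fu] [m Fv]; exists (Num.max n m).
  by apply: lspan_lin; [apply: Fil_mono Fu|apply: Fil_mono Fv]; rewrite le_max lexx ?orbT.
move=> x w [m Fw]; elim/SV_ind: x => [|a b x [n IH]].
  by exists 0; rewrite lact0; exact: lspan0.
exists (Num.max (deg b + m) n); rewrite lact_lin; apply: lspan_lin.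
  by apply: Fil_mono (Fil_letter b Fw); rewrite le_max lexx.
by apply: Fil_mono IH; rewrite le_max lexx orbT.
Qed.

Lemma lower_submodule (W : I -> Prop) m w :
  is_submodule W -> W w -> W (lower m w).
Proof. by move=> [_ _ WA]; elim: m w => //= a m IH w Ww; apply/IH/WA. Qed.

(** Lowering a nonzero vector of a submodule yields a nonzero vector of the image of V; simplicity
    of V gives the whole image, which generates. *)
Lemma iota_simple : simple_module V -> (forall v, iota v = 0 -> v = 0) -> simple_module I.
Proof.
move=> [[v0 v0N0] sV] iota_inj; split.
  by exists (iota v0); apply: contra_neq v0N0; exact: iota_inj.
move=> W sW; have [W0|/existsNP [w /not_implyP [Ww wN0]]] := pselect (forall w, W w -> w = 0).
  by left.
right; have [n Fw] := Fil_exists w.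
have [m [v [vN0 Ev]]] : exists m v, v != 0 /\ lower m w = iota v.
  by apply: Fil_lower Fw _; apply/eqP.
have [sW0 sWD sWA] := sW.
have [] := sV (fun v => W (iota v)).
- split; first by rewrite linear0.
    by move=> a u u' Wu Wu'; rewrite linearP; exact: sWD.
  by move=> x u Wu; rewrite -iota_act; exact: sWA.
- move=> /(_ v); rewrite -Ev => /(_ (lower_submodule _ sW Ww)) v0'.
  by rewrite v0' eqxx in vN0.
exact: I_generated.
Qed.

Lemma deg_lt0_nilpotent b : deg b < 0 -> locally_nilpotent I (svb b).
Proof.
move=> b0 w; have [n Fw] := Fil_exists w.
(* Each application lowers the degree by at least 1, so |n| + 1 of them lead from degree n below
   0. *)
exists (absz n).+1; split=> //; apply: (@Fil_lt0 (n - (absz n).+1%:Z)); first by lia.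
elim: (absz n).+1 => [|k IH]; first by rewrite subr0.
by rewrite iterS; apply: Fil_mono (Fil_letter b IH); lia.
Qed.

End Filtration.

(** * Simplicity and local nilpotency for Ind(V) *)

Theorem theorem3p3 (R : realType) (lam mu : R[i]) (d1 d2 : nat)
  (hd : 2 * d2%:Z - 1 <= d1%:Z)
  (V : lieModType (SVsub lam mu hd))
  (c : R[i])
  (hC : forall z : SVsub lam mu hd, \val z = svC ->
     forall v : V, lact z v = c *: v)
  (hV : simple_module V)
  (t : nat)
  (ha : forall x : SVsub lam mu hd, \val x = svM t%:Z ->
     injective (fun v : V => lact x v))
  (hbM : forall (i : int) (x : SVsub lam mu hd), t%:Z < i -> \val x = svM i ->
     forall v : V, lact x v = 0)
  (hbY : forall (j : int) (x : SVsub lam mu hd), t%:Z + d2%:Z < j ->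
     \val x = svY j -> forall v : V, lact x v = 0)
  (hbL : forall (k : int) (x : SVsub lam mu hd), t%:Z + d1%:Z < k ->
     \val x = svL k -> forall v : V, lact x v = 0)
  (hc : forall i : nat, (0 < i)%N ->
     ((lam + 1) * i%:R + t%:R + 2 * mu)
     * (i%:R + d1%:R + lam * (i%:R + t%:R + d1%:R) - 2 * mu) != 0) :
  simple_module (Ind V) /\
  [/\ forall i : int, t%:Z < i -> locally_nilpotent (Ind V) (svM i),
      forall j : int, t%:Z + d2%:Z < j -> locally_nilpotent (Ind V) (svY j)
    & forall k : int, t%:Z + d1%:Z < k -> locally_nilpotent (Ind V) (svL k)].
Proof.
(* The letters of negative degree are exactly those of condition (b), which are also those of
   conclusion (II). *)
have deg_lt0_act b (x : SVsub lam mu hd) (v : V) :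
    letter_deg d1 d2 t b < 0 -> \val x = sv_basis lam mu b -> lact x v = 0.
  case: b => [m|m|m|] //= m0 xE.
  - by apply: (hbL m) xE _; move: m0; repeat case: ifP; lia.
  - by apply: (hbM m) xE _; move: m0; repeat case: ifP; lia.
  - by apply: (hbY m) xE _; move: m0; repeat case: ifP; lia.
have Mt_in : sub_letter d1 d2 (bM t%:Z) by rewrite /=; lia.
pose xt : SVsub lam mu hd := exist _ (svM t%:Z) (sub_letterP lam mu hd Mt_in).
have iota_act (x : SVsub lam mu hd) v :
    lact (\val x) (tens 1 v : Ind V) = tens 1 (lact x v) by exact: Ind_act_tens1.
have gen W : is_submodule W -> (forall v, W (tens 1 v)) -> forall w : Ind V, W w.
  exact: Ind_generated.
have nil b : letter_deg d1 d2 t b < 0 -> locally_nilpotent (Ind V) (sv_basis lam mu b).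
  exact: (deg_lt0_nilpotent iota_act deg_lt0_act gen).
split; last first.
  split=> i i0; [apply: (nil (bM i))|apply: (nil (bY i))|apply: (nil (bL i))] => /=;
    by repeat case: ifP; lia.
apply: (iota_simple iota_act deg_lt0_act (xt := xt)) => //.
- by move=> a ha'; exact: (dual_coef_neq0 ha' hc).
- exact: ha.
- exact: sv_tens1_eq0.
Qed.
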